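(* Let $\Lambda=\begin{pmatrix} A & N \\ M & B \end{pmatrix}$ be a Morita ring which is an Artin algebra, with $M\otimes_A N=0=N\otimes_B M$. Assume that ${}_BM$, ${}_AN$, $M_A$ and $N_B$ are projective modules. Then $\Lambda$ is left weakly Gorenstein if and only if $A$ and $B$ are left weakly Gorenstein.
   Context: All modules are finitely generated. $A$ and $B$ are Artin $R$-algebras over a commutative artinian ring $R$; ${}_BM_A$ and ${}_AN_B$ are bimodules, finitely generated over $R$, on which $R$ acts centrally. A Morita ring $\Lambda$ is the set of matrices $\begin{pmatrix} a & n \\ m & b \end{pmatrix}$ with multiplication defined using bimodule maps $\phi:M\otimes_AN\to B$ and $\psi:N\otimes_BM\to A$; since here $M\otimes_AN=0=N\otimes_BM$, $\phi=0=\psi$ and $$\begin{pmatrix} a & n \\ m & b \end{pmatrix}\begin{pmatrix} a' & n' \\ m' & b' \end{pmatrix}=\begin{pmatrix} aa' & an'+nb' \\ ma'+bm' & bb' \end{pmatrix}.$$ For an Artin algebra $R'$: a left $R'$-module $Z$ is semi-Gorenstein-projective if $\operatorname{Ext}^i_{R'}(Z,R')=0$ for all $i\ge 1$. A left $R'$-module $G$ is Gorenstein-projective if there is an acyclic complex $P^\bullet:\cdots\to P^{-1}\to P^0\xrightarrow{d_0}P^1\to\cdots$ of finitely generated projective left $R'$-modules such that $\operatorname{Hom}_{R'}(P^\bullet,P)$ is acyclic for every finitely generated projective $P$, and $G\cong\operatorname{Ker}d_0$. $R'$ is left weakly Gorenstein if every semi-Gorenstein-projective left $R'$-module is Gorenstein-projective.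 *)

(* Defs.v *)
(* MathComp. *)
From HB Require Import structures.
From mathcomp Require Import all_boot all_order all_algebra.

Set Implicit Arguments.
Unset Strict Implicit.
Unset Printing Implicit Defensive.

Import GRing.Theory.

Local Open Scope ring_scope.

(* [V] is generated by finitely many elements over [R], where [R] acts on the
   [S]-module [V] through [i : R -> S]. *)
Definition fg_via (R S : pzRingType) (i : R -> S) (V : lmodType S) : Prop :=
  exists s : seq V, forall v : V,
    exists c : nat -> R, v = \sum_(k < size s) i (c k) *: s`_k.

Definition finitely_generated (S : pzRingType) (V : lmodType S) : Prop :=
  @fg_via S S idfun V.

Definition is_ideal (R : comPzRingType) (I : R -> Prop) : Prop :=
  [/\ I 0, forall x y, I x -> I y -> I (x + y) & forall a x, I x -> I (a * x)].

Definition artinian (R : comPzRingType) : Prop :=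
  forall I : nat -> R -> Prop,
    (forall n, is_ideal (I n)) ->
    (forall n x, I n.+1 x -> I n x) ->
    exists n, forall m, (n <= m)%N -> forall x, I n x -> I m x.

(* The [R]-algebra structure on [A] is given by its structure map into the
   centre of [A]. *)
Definition artin_algebra (R : comPzRingType) (A : pzRingType)
    (i : {rmorphism R -> A}) : Prop :=
  [/\ artinian R, forall r a, i r * a = a * i r & fg_via i A^o].

(* A [B]-[A]-bimodule is a left [B]-module with a compatible right action
   [rscale] of [A]. *)
HB.mixin Record isBimodule (B A : pzRingType) M of GRing.Lmodule B M := {
  rscale : M -> A -> M;
  rscaleA : forall m a a', rscale (rscale m a) a' = rscale m (a * a');
  rscale1 : forall m, rscale m 1 = m;
  rscaleDl : forall m m' a, rscale (m + m') a = rscale m a + rscale m' a;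
  rscaleDr : forall m a a', rscale m (a + a') = rscale m a + rscale m a';
  rscaleAl : forall (b : B) m a, rscale (b *: m) a = b *: rscale m a
}.

#[short(type="bimodType")]
HB.structure Definition Bimodule (B A : pzRingType) :=
  {M of GRing.Lmodule B M & isBimodule B A M}.

Notation "m *> a" := (rscale m a) (at level 40, left associativity) : ring_scope.

Lemma rscale0l (B A : pzRingType) (M : bimodType B A) (a : A) :
  (0 : M) *> a = 0.
Proof. by apply: (@addrI _ ((0 : M) *> a)); rewrite -rscaleDl !addr0. Qed.

(* The underlying right [A]-module of a [B]-[A]-bimodule, as a left module over
   the opposite ring [A^c]. *)
Definition right_mod (B A : pzRingType) (M : bimodType B A) : Type := M.

Section RightMod.
Variables (B A : pzRingType) (M : bimodType B A).

HB.instance Definition _ := GRing.Zmodule.on (right_mod M).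

Let scale (a : A^c) (m : right_mod M) : right_mod M := (m : M) *> (a : A).

Let scaleA a b v : scale a (scale b v) = scale (a * b) v.
Proof. exact: rscaleA. Qed.
Let scale1 : left_id 1 scale.
Proof. exact: rscale1. Qed.
Let scaleDr : right_distributive scale +%R.
Proof. by move=> a u v; apply: rscaleDl. Qed.
Let scaleDl v : {morph scale^~ v : a b / a + b}.
Proof. by move=> a b; apply: rscaleDr. Qed.

HB.instance Definition _ := GRing.Zmodule_isLmodule.Build A^c (right_mod M)
  scaleA scale1 scaleDr scaleDl.
End RightMod.

(* [M] is finitely generated over [R], and [R] acts centrally on it, when [R]
   acts through [iB : R -> B] on the left and [iA : R -> A] on the right. *)
Definition central_fg_bimodule (R : comPzRingType) (B A : pzRingType)
    (iB : {rmorphism R -> B}) (iA : {rmorphism R -> A}) (M : bimodType B A) :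
    Prop :=
  (forall r (m : M), iB r *: m = m *> iA r) /\ fg_via iB M.

Section Tensor.
Variables (A : pzRingType) (U : lmodType A^c) (V : lmodType A).

Definition balanced (W : zmodType) (f : U -> V -> W) : Prop :=
  [/\ forall u u' v, f (u + u') v = f u v + f u' v,
      forall u v v', f u (v + v') = f u v + f u v'
    & forall (a : A) u v, f ((a : A^c) *: u) v = f u (a *: v)].

(* [T], with [t u v] in the role of [u \otimes v], is the tensor product of the
   right module [U] and the left module [V]. *)
Definition is_tensor_product (T : zmodType) (t : U -> V -> T) : Prop :=
  balanced t /\
  forall (W : zmodType) (f : U -> V -> W), balanced f ->
    exists h : {additive T -> W},
      (forall u v, h (t u v) = f u v) /\
      (forall h' : {additive T -> W},
         (forall u v, h' (t u v) = f u v) -> h' =1 h).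

Definition tensor_eq0 : Prop :=
  exists (T : zmodType) (t : U -> V -> T),
    is_tensor_product t /\ forall x : T, x = 0.
End Tensor.

Section Homological.
Variable S : pzRingType.

Definition projective (P : lmodType S) : Prop :=
  forall (U V : lmodType S) (g : {linear U -> V}) (f : {linear P -> V}),
    (forall v, exists u, g u = v) ->
    exists h : {linear P -> U}, forall x, g (h x) = f x.

Definition exact_at (U V W : lmodType S)
    (f : {linear U -> V}) (g : {linear V -> W}) : Prop :=
  forall v, g v = 0 <-> exists u, f u = v.

(* Exactness at [Hom(V, Q)] of [Hom(W, Q) -> Hom(V, Q) -> Hom(U, Q)]. *)
Definition hom_exact_at (U V W : lmodType S)
    (f : {linear U -> V}) (g : {linear V -> W}) (Q : lmodType S) : Prop :=
  forall h : {linear V -> Q},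
    (forall u, h (f u) = 0) <->
    exists k : {linear W -> Q}, forall v, k (g v) = h v.

Definition projective_resolution (Z : lmodType S) (P : nat -> lmodType S)
    (d : forall n, {linear P n.+1 -> P n}) (e : {linear P 0%N -> Z}) : Prop :=
  [/\ forall n, projective (P n),
      forall z, exists x, e x = z,
      exact_at (d 0%N) e
    & forall n, exact_at (d n.+1) (d n)].

(* [Ext^i(Z, W) = 0]: the cohomology of [Hom(P, W)] in degree [i] vanishes, for
   every projective resolution [P] of [Z]; resolutions need not consist of
   finitely generated modules, so that they exist over any ring. *)
Definition Ext_eq0 (i : nat) (Z W : lmodType S) : Prop :=
  forall (P : nat -> lmodType S) (d : forall n, {linear P n.+1 -> P n})
         (e : {linear P 0%N -> Z}),
    projective_resolution d e ->
    match i with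
    | 0 => forall h : {linear P 0%N -> W},
             (forall x, h (d 0%N x) = 0) -> forall x, h x = 0
    | n.+1 => hom_exact_at (d n.+1) (d n) W
    end.

Definition semi_gorenstein_projective (Z : lmodType S) : Prop :=
  forall i : nat, (1 <= i)%N -> Ext_eq0 i Z S^o.

(* The last clause says that [j] is an isomorphism of [G] onto [Ker (d 0)]. *)
Definition gorenstein_projective (G : lmodType S) : Prop :=
  exists (P : int -> lmodType S) (d : forall i, {linear P i -> P (i + 1)}),
    [/\ forall i, finitely_generated (P i) /\ projective (P i),
        forall i, exact_at (d i) (d (i + 1)),
        forall Q : lmodType S, finitely_generated Q -> projective Q ->
          forall i, hom_exact_at (d i) (d (i + 1)) Q
      & exists j : {linear G -> P 0},
          injective j /\ forall x, d 0 x = 0 <-> exists g, j g = x].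

Definition left_weakly_gorenstein : Prop :=
  forall Z : lmodType S, finitely_generated Z ->
    semi_gorenstein_projective Z -> gorenstein_projective Z.
End Homological.

(* The matrices [[a, n], [m, b]]. Products [n m] and [m n] are zero: when
   [M \otimes_A N = 0 = N \otimes_B M], the bimodule maps
   [M \otimes_A N -> B] and [N \otimes_B M -> A] of a Morita ring vanish. *)
Record morita (A B : pzRingType) (M : bimodType B A) (N : bimodType A B) :=
  Morita { mor_a : A; mor_n : N; mor_m : M; mor_b : B }.

Section MoritaRing.
Variables (A B : pzRingType) (M : bimodType B A) (N : bimodType A B).

Local Notation L := (morita M N).

Let enc (x : L) : A * N * M * B := (mor_a x, mor_n x, mor_m x, mor_b x).
Let dec (t : A * N * M * B) : L :=
  let: (a, n, m, b) := t in Morita a n m b.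
Let encK : cancel enc dec. Proof. by case. Qed.

HB.instance Definition _ := Choice.copy L (can_type encK).

Definition mor_zero : L := Morita 0 0 0 0.
Definition mor_opp (x : L) : L :=
  Morita (- mor_a x) (- mor_n x) (- mor_m x) (- mor_b x).
Definition mor_add (x y : L) : L :=
  Morita (mor_a x + mor_a y) (mor_n x + mor_n y)
         (mor_m x + mor_m y) (mor_b x + mor_b y).

Let addA : associative mor_add.
Proof. by move=> [? ? ? ?] [? ? ? ?] [? ? ? ?]; rewrite /mor_add /= !addrA. Qed.
Let addC : commutative mor_add.
Proof.
by move=> [a n m b] [a' n' m' b']; congr Morita; apply: addrC.
Qed.
Let add0 : left_id mor_zero mor_add.
Proof. by move=> [? ? ? ?]; rewrite /mor_add /= !add0r. Qed.
Let addN : left_inverse mor_zero mor_opp mor_add.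
Proof. by move=> [? ? ? ?]; rewrite /mor_add /= !addNr. Qed.

HB.instance Definition _ := GRing.isZmodule.Build L addA addC add0 addN.

Definition mor_one : L := Morita 1 0 0 1.
Definition mor_mul (x y : L) : L :=
  Morita (mor_a x * mor_a y)
         (mor_a x *: mor_n y + mor_n x *> mor_b y)
         (mor_m x *> mor_a y + mor_b x *: mor_m y)
         (mor_b x * mor_b y).

Let mulA : associative mor_mul.
Proof.
move=> [a n m b] [a' n' m' b'] [a'' n'' m'' b'']; rewrite /mor_mul /=.
rewrite !scalerDr !rscaleDl !scalerA !rscaleA !rscaleAl !mulrA.
by rewrite !addrA.
Qed.
Let mul1 : left_id mor_one mor_mul.
Proof.
by move=> [? ? ? ?]; rewrite /mor_mul /= !mul1r !scale1r !rscale0l addr0 add0r.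
Qed.
Let mulr1' : right_id mor_one mor_mul.
Proof.
by move=> [? ? ? ?]; rewrite /mor_mul /= !mulr1 !rscale1 !scaler0 addr0 add0r.
Qed.
Let mulDl : left_distributive mor_mul mor_add.
Proof.
move=> [? ? ? ?] [? ? ? ?] [? ? ? ?]; rewrite /mor_mul /mor_add /=.
by rewrite !mulrDl !rscaleDl !scalerDl; congr Morita; apply: addrACA.
Qed.
Let mulDr : right_distributive mor_mul mor_add.
Proof.
move=> [? ? ? ?] [? ? ? ?] [? ? ? ?]; rewrite /mor_mul /mor_add /=.
by rewrite !mulrDr !rscaleDr !scalerDr; congr Morita; apply: addrACA.
Qed.

HB.instance Definition _ := GRing.Zmodule_isPzRing.Build L
  mulA mul1 mulr1' mulDl mulDr.
End MoritaRing.

(* The [R]-algebra structure on the Morita ring: scalars act diagonally. *)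
Definition morita_scalar (R A B : pzRingType) (M : bimodType B A)
    (N : bimodType A B) (iA : {rmorphism R -> A}) (iB : {rmorphism R -> B})
    (r : R) : morita M N :=
  Morita (iA r) 0 0 (iB r).

Section MoritaAlgebra.
Variables (R : comPzRingType) (A B : pzRingType).
Variables (M : bimodType B A) (N : bimodType A B).
Variables (iA : {rmorphism R -> A}) (iB : {rmorphism R -> B}).

Local Notation iL := (morita_scalar M N iA iB).

Let iL_additive : zmod_morphism iL.
Proof.
move=> r s; rewrite /morita_scalar !rmorphB.
by congr Morita; rewrite /= subr0.
Qed.

HB.instance Definition _ :=
  GRing.isZmodMorphism.Build R (morita M N) iL iL_additive.

Let iL_multiplicative : monoid_morphism iL.
Proof.
split; first by rewrite /morita_scalar !rmorph1.
move=> r s; rewrite /morita_scalar !rmorphM; congr Morita => /=.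
  by rewrite scaler0 rscale0l addr0.
by rewrite scaler0 rscale0l addr0.
Qed.

HB.instance Definition _ :=
  GRing.isMonoidMorphism.Build R (morita M N) iL iL_multiplicative.

Let spanned (S : pzRingType) (i : R -> S) (V : lmodType S) (s : seq V) v :=
  exists c : nat -> R, v = \sum_(k < size s) i (c k) *: s`_k.

Let spannedD (S : pzRingType) (i : R -> S) (V : lmodType S) (s t : seq V) u v :
  spanned i s u -> spanned i t v -> spanned i (s ++ t) (u + v).
Proof.
move=> [c ->] [d ->].
pose e k := if (k < size s)%N then c k else d (k - size s)%N; exists e.
rewrite -(big_mkord xpredT (fun k => i (c k) *: s`_k)).
rewrite -(big_mkord xpredT (fun k => i (d k) *: t`_k)).
rewrite -(big_mkord xpredT (fun k => i (e k) *: (s ++ t)`_k)) size_cat [RHS](big_cat_nat (n := size s)) ?leq_addr //=.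
congr (_ + _); first by apply: eq_big_nat => k /andP[_ ks]; rewrite nth_cat /e ks.
rewrite -[X in _ = \sum_(X <= _ < _) _]add0n big_addn addKn.
apply: eq_big_nat => k _.
by rewrite nth_cat /e ltnNge leq_addl /= addnK.
Qed.

Let spanned_map (S S' : pzRingType) (i : R -> S) (i' : R -> S')
    (V : lmodType S) (V' : lmodType S') (f : V -> V') (s : seq V) v :
  f 0 = 0 -> {morph f : x y / x + y} ->
  (forall r x, f (i r *: x) = i' r *: f x) ->
  spanned i s v -> spanned i' (map f s) (f v).
Proof.
move=> f0 fD fZ [c ->]; exists c; rewrite (big_morph f fD f0) size_map.
by apply: eq_bigr => k _; rewrite fZ (nth_map 0).
Qed.

(* The Morita ring of central finitely generated bimodules over Artin algebras
   is itself an Artin algebra. *)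
Lemma morita_artin_algebra :
  artin_algebra iA -> artin_algebra iB ->
  central_fg_bimodule iB iA M -> central_fg_bimodule iA iB N ->
  artin_algebra iL.
Proof.
move=> [artR cA [sA gA]] [_ cB [sB gB]] [cM [sM gM]] [cN [sN gN]]; split=> //.
  move=> r [a n m b]; congr Morita => /=; first exact: cA; last exact: cB.
    by rewrite rscale0l scaler0 addr0 add0r cN.
  by rewrite rscale0l scaler0 addr0 add0r cM.
pose fA (a : A^o) : (morita M N)^o := @Morita A B M N a 0 0 0.
pose fN (n : N) : (morita M N)^o := @Morita A B M N 0 n 0 0.
pose fM (m : M) : (morita M N)^o := @Morita A B M N 0 0 m 0.
pose fB (b : B^o) : (morita M N)^o := @Morita A B M N 0 0 0 b.
exists (map fA sA ++ (map fN sN ++ (map fM sM ++ map fB sB))) => x.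
have -> : x = fA (mor_a x) + (fN (mor_n x) + (fM (mor_m x) + fB (mor_b x))).
  by case: x => a n m b; congr Morita; rewrite /= ?addr0 ?add0r.
apply: spannedD; last apply: spannedD; last apply: spannedD.
- apply: (spanned_map (i := iA)) (gA _) => // [u v|r u].
    by congr Morita; rewrite /= addr0.
  by congr Morita; rewrite /= ?scaler0 ?rscale0l ?mulr0 ?addr0.
- apply: (spanned_map (i := iA)) (gN _) => // [u v|r u].
    by congr Morita; rewrite /= addr0.
  by congr Morita; rewrite /= ?scaler0 ?rscale0l ?mulr0 ?addr0.
- apply: (spanned_map (i := iB)) (gM _) => // [u v|r u].
    by congr Morita; rewrite /= addr0.
  by congr Morita; rewrite /= ?scaler0 ?rscale0l ?mulr0 ?add0r.
- apply: (spanned_map (i := iB)) (gB _) => // [u v|r u].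
    by congr Morita; rewrite /= addr0.
  by congr Morita; rewrite /= ?scaler0 ?rscale0l ?mulr0 ?addr0.
Qed.
End MoritaAlgebra.

(* Main.v *)
(* Write [L] for the Morita ring. Over an Artin algebra [S], left approximations
   [Z -> S ^ r] exist, so that [S] is left weakly Gorenstein if and only if
   every semi-Gorenstein-projective module is torsionless, i.e. embeds in a free
   module.

   If [L] has this property and [X] is a semi-Gorenstein-projective [A]-module,
   then [L e_A \otimes_A X = (X, M \otimes_A X)] is semi-Gorenstein-projective,
   because this functor is exact, preserves projectives and has the exact right
   adjoint [Z |-> e_A Z]. It is therefore torsionless, and so is [X], since [e_A L]
   is the projective [A]-module [A \oplus N].

   Conversely, let [Z] be a semi-Gorenstein-projective [L]-module. The left module
   [A], with the resolution [0 -> M -> L e_A -> A -> 0], and the right module [A]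
   both have projective dimension at most one. By the first fact, every map from
   a semi-Gorenstein-projective module to [A] lifts to [L]; by the second, the base
   change [A \otimes_L -] is exact on syzygies. So it takes a syzygy [K] of [Z] to
   a semi-Gorenstein-projective, hence torsionless [A]-module, which embeds in a
   free one; hence base change is exact on the presentation of [Z], too, and
   [A \otimes_L Z] is torsionless. Thus maps [Z -> L] detect the elements of [Z]
   that survive in [A \otimes_L Z] or in [B \otimes_L Z]. An element
   [x = \sum_j n_j y_j] of [N Z] is detected through the elements
   [\sum_j nu(n_j) y_j], [nu] in [Hom_B(N, B)]: not all of them can vanish in
   [B \otimes_L Z], because the trace ideal of [N] annihilates [M]. *)

Require Import Defs.
From HB Require Import structures.
From mathcomp Require Import all_boot all_order all_algebra.
From mathcomp Require Import boolp.

Set Implicit Arguments.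
Unset Strict Implicit.
Unset Printing Implicit Defensive.

Import GRing.Theory.
Local Open Scope ring_scope.

(** * Modules over a ring: kernels and quotients *)

(** The linearity proof is carried in the term, so that the canonical linear structure can be
    inferred from it. *)
Definition lin_of (S : pzRingType) (U V : lmodType S) (f : U -> V)
  (_ : linear f) : U -> V := f.

Section LinOf.
Variables (S : pzRingType) (U V : lmodType S) (f : U -> V) (lf : linear f).
HB.instance Definition _ := GRing.isLinear.Build S U V *:%R (lin_of lf) lf.
Definition mklin : {linear U -> V} := lin_of lf.
Lemma mklinE : mklin =1 f. Proof. by []. Qed.
End LinOf.

Definition zmor_of (U V : zmodType) (f : U -> V) (_ : {morph f : x y / x - y}) :
  U -> V := f.

Section ZmorOf.
Variables (U V : zmodType) (f : U -> V) (fB : {morph f : x y / x - y}).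
HB.instance Definition _ := GRing.isZmodMorphism.Build U V (zmor_of fB) fB.
Definition mkadd : {additive U -> V} := zmor_of fB.
Lemma mkaddE : mkadd =1 f. Proof. by []. Qed.
End ZmorOf.

Section Modules.
Variable S : pzRingType.
Implicit Types U V W P Z K : lmodType S.

Definition surj (T T' : Type) (f : T -> T') := forall y, exists x, f x = y.

Lemma factor_surj U V W (q : {linear U -> V}) (f : {linear U -> W}) :
  surj q -> (forall u, q u = 0 -> f u = 0) ->
  exists g : {linear V -> W}, forall u, g (q u) = f u.
Proof.
move=> /choice[s qs] qf.
have fs u v : q u = q v -> f u = f v.
  by move=> /eqP; rewrite -subr_eq0 -linearB => /eqP /qf /eqP;
    rewrite linearB subr_eq0 => /eqP.
have lg : linear (fun v => f (s v)).
  by move=> a u v; rewrite -linearP; apply: fs; rewrite linearP !qs.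
by exists (mklin lg) => u; apply: fs; rewrite qs.
Qed.

Lemma factor_inj U V W (i : {linear U -> V}) (f : {linear W -> V}) :
  injective i -> (forall w, exists u, i u = f w) ->
  exists g : {linear W -> U}, forall w, i (g w) = f w.
Proof.
move=> ii /choice[s is_].
have lg : linear s by move=> a u v; apply: ii; rewrite linearP !is_ linearP.
by exists (mklin lg).
Qed.

Lemma ker_inj U V (i : {linear U -> V}) :
  (forall u, i u = 0 -> u = 0) -> injective i.
Proof.
move=> i0 u v /eqP; rewrite -subr_eq0 -linearB => /eqP /i0 /eqP.
by rewrite subr_eq0 => /eqP.
Qed.

Definition row_lin V k (g : 'I_k -> V) (v : 'rV[S]_k) : V :=
  \sum_j v 0 j *: g j.

Lemma row_lin_linear V k (g : 'I_k -> V) : linear (row_lin g).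
Proof.
move=> a u v; rewrite /row_lin scaler_sumr -big_split; apply: eq_bigr => j _.
by rewrite !mxE scalerDl scalerA.
Qed.

Lemma row_lin_exists V k (g : 'I_k -> V) :
  exists f : {linear 'rV[S]_k -> V}, forall v, f v = \sum_j v 0 j *: g j.
Proof. by exists (mklin (row_lin_linear g)). Qed.

Lemma row_sum k (v : 'rV[S]_k) : v = \sum_j v 0 j *: delta_mx 0 j.
Proof. exact: row_sum_delta. Qed.

Lemma lin_row V k (f : {linear 'rV[S]_k -> V}) v :
  f v = \sum_j v 0 j *: f (delta_mx 0 j).
Proof.
by rewrite {1}(row_sum v) linear_sum; apply: eq_bigr => j _; rewrite linearZ.
Qed.

Lemma row_projective k : projective 'rV[S]_k.
Proof.
move=> U V g f gs.
have [u gu] := choice (fun j : 'I_k => gs (f (delta_mx 0 j))).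
have [h hE] := row_lin_exists u; exists h => v.
rewrite hE linear_sum (lin_row f v); apply: eq_bigr => j _.
by rewrite linearZ gu.
Qed.

Lemma fg_surj V : finitely_generated V <->
  exists k (p : {linear 'rV[S]_k -> V}), surj p.
Proof.
split=> [[s sV]|[k [p ps]]].
  have [p pE] := row_lin_exists (fun j : 'I_(size s) => s`_j).
  exists (size s), p => v; have [c ->] := sV v.
  by exists (\row_j c j); rewrite pE; apply: eq_bigr => j _; rewrite mxE.
exists (codom (fun j : 'I_k => p (delta_mx 0 j))) => v; have [w <-] := ps v.
pose c n := if insub n is Some j then w 0 j else 0 : S.
exists c; rewrite (lin_row p) size_codom.
rewrite -[RHS](big_mkord xpredT (fun j =>
  idfun (c j) *: _`_j)) card_ord big_mkord.
apply: eq_bigr => j _; rewrite /c valK; congr (_ *: _).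
have := nth_codom 0 (fun j : 'I_k =>
  p (delta_mx 0 j)) (cast_ord (esym (card_ord k)) j).
by rewrite /= => ->; rewrite /= enum_val_ord cast_ordKV.
Qed.

Lemma row_fg k : finitely_generated 'rV[S]_k.
Proof. by apply/fg_surj; exists k, idfun => v; exists v. Qed.

Lemma fg_image U V (f : {linear U -> V}) :
  finitely_generated U -> surj f -> finitely_generated V.
Proof.
move=> /fg_surj[k [p ps]] fs; apply/fg_surj; exists k, (f \o p) => v.
by have [u <-] := fs v; have [w <-] := ps u; exists w.
Qed.
End Modules.

Section Kernel.
Variables (S : pzRingType) (U V : lmodType S) (f : {linear U -> V}).

Definition ker_pred : pred U := fun u => f u == 0.

Lemma ker_pred_closed : subsemimod_closed ker_pred.
Proof.
split; first split; first by rewrite unfold_in /ker_pred linear0.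
  by move=> u v; rewrite !unfold_in /ker_pred linearD => /eqP -> /eqP ->;
    rewrite addr0.
by move=> a u; rewrite !unfold_in /ker_pred linearZ /= => /eqP ->;
  rewrite scaler0.
Qed.

Record kernel := Kernel { ker_val : U; ker_valP : ker_val \in ker_pred }.
HB.instance Definition _ := [isSub of kernel for ker_val].
HB.instance Definition _ := [Choice of kernel by <:].
HB.instance Definition _ :=
  GRing.SubChoice_isSubLmodule.Build S U ker_pred kernel ker_pred_closed.
End Kernel.

Lemma ker_exists (S : pzRingType) (U V : lmodType S) (f : {linear U -> V}) :
  exists (K : lmodType S) (i : {linear K -> U}),
    injective i /\ exact_at i f.
Proof.
exists (kernel f), (\val : kernel f -> U); split; first exact: val_inj.
move=> u; split=> [fu0|[[v v0] <-]]; last exact/eqP.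
by exists (Kernel (introT eqP fu0 : u \in ker_pred f)).
Qed.
Record submodule (S : pzRingType) (V : lmodType S) (Q : V -> Prop) : Prop :=
  Submodule { submod0 : Q 0; submodD : forall u v, Q u -> Q v -> Q (u + v);
              submodZ : forall a v, Q v -> Q (a *: v) }.

Section SubmoduleTheory.
Variables (S : pzRingType) (V : lmodType S) (Q : V -> Prop).
Hypothesis subQ : submodule Q.

Lemma submodN v : Q v -> Q (- v).
Proof. by rewrite -scaleN1r; apply: (submodZ subQ). Qed.

Lemma submodB u v : Q u -> Q v -> Q (u - v).
Proof. by move=> Qu /submodN; apply: (submodD subQ). Qed.

Lemma submod_sum (I : Type) (r : seq I) (F : I -> V) :
  (forall i, Q (F i)) -> Q (\sum_(i <- r) F i).
Proof. by move=> QF; apply: big_ind => //; case: subQ. Qed.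
End SubmoduleTheory.

Section Quotient.
Variables (S : pzRingType) (V : lmodType S) (Q : V ->
  Prop) (subQ : submodule Q).

(** [choose] sees only the coset predicate, so it picks one element in each coset of [Q]; [quotient]
    is the subtype of these elements. *)
Definition quo_repr (v : V) : V := choose (fun w => `[< Q (v - w) >]) v.

Lemma quo_reprP v : Q (v - quo_repr v).
Proof.
apply/asboolP; apply: (@chooseP _ (fun w => `[< Q (v - w) >]) v).
by apply/asboolP; rewrite subrr; apply: submod0.
Qed.

Lemma quo_repr_eq v w : quo_repr v = quo_repr w <-> Q (v - w).
Proof.
split=> [vw|Qvw].
  have := submodB subQ (quo_reprP v) (quo_reprP w).
  by rewrite vw opprB addrA subrK.
rewrite /quo_repr; have eqvw : (fun u => `[< Q (v - u) >]) =1 (fun u =>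
  `[< Q (w - u) >]).
  move=> u; apply/asboolP/asboolP => Qu.
    by have := submodB subQ Qu Qvw;
      rewrite opprB addrACA [v + _]addrC addrACA subrr addr0 addrC.
  by have := submodD subQ Qu Qvw; rewrite addrC addrA subrK.
rewrite (eq_choose eqvw); apply: choose_id; apply/asboolP.
  by rewrite -opprB; apply: submodN.
by rewrite subrr; apply: submod0.
Qed.

Definition quo_pred (_ : submodule Q) : pred V := fun v => quo_repr v == v.

Lemma quo_repr_id v : quo_repr (quo_repr v) = quo_repr v.
Proof. by apply/quo_repr_eq; rewrite -opprB; apply: submodN => //;
  apply: quo_reprP. Qed.

Record quotient := QuotientElt { quo_val : V;
  quo_valP : quo_pred subQ quo_val }.
HB.instance Definition _ := [isSub of quotient for quo_val].
HB.instance Definition _ := [Choice of quotient by <:].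

Definition quo_pi (v : V) : quotient :=
  QuotientElt (introT eqP (quo_repr_id v)).

Lemma quo_piK (x : quotient) : quo_pi (quo_val x) = x.
Proof. by case: x => v v0; apply: val_inj; apply/eqP. Qed.

Lemma quo_pi_eq v w : quo_pi v = quo_pi w <-> Q (v - w).
Proof.
split=> [/(congr1 val)/quo_repr_eq //|/quo_repr_eq vw].
exact: val_inj.
Qed.

Lemma quo_valK v : Q (quo_val (quo_pi v) - v).
Proof. by rewrite -opprB; apply: submodN => //; apply: quo_reprP. Qed.

Definition quo_zero := quo_pi 0.
Definition quo_opp x := quo_pi (- quo_val x).
Definition quo_add x y := quo_pi (quo_val x + quo_val y).
Definition quo_scale a x := quo_pi (a *: quo_val x).

Lemma quo_piD v w : quo_add (quo_pi v) (quo_pi w) = quo_pi (v + w).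
Proof.
apply/quo_pi_eq; rewrite opprD addrACA.
by apply: (submodD subQ); apply: quo_valK.
Qed.

Lemma quo_piN v : quo_opp (quo_pi v) = quo_pi (- v).
Proof. by apply/quo_pi_eq; rewrite -opprD; apply: submodN => //;
  apply: quo_valK. Qed.

Lemma quo_piZ a v : quo_scale a (quo_pi v) = quo_pi (a *: v).
Proof. by apply/quo_pi_eq; rewrite -scalerBr; apply: (submodZ subQ);
  apply: quo_valK. Qed.

Lemma quo_addA : associative quo_add.
Proof. by move=> x y z; rewrite -(quo_piK x) -(quo_piK y) -(quo_piK z) !quo_piD
  addrA. Qed.

Lemma quo_addC : commutative quo_add.
Proof. by move=> x y; rewrite /quo_add addrC. Qed.

Lemma quo_add0 : left_id quo_zero quo_add.
Proof. by move=> x; rewrite -(quo_piK x) quo_piD add0r. Qed.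

Lemma quo_addN : left_inverse quo_zero quo_opp quo_add.
Proof. by move=> x; rewrite -(quo_piK x) quo_piN quo_piD addNr. Qed.

HB.instance Definition _ :=
  GRing.isZmodule.Build quotient quo_addA quo_addC quo_add0 quo_addN.

Lemma quo_scaleA a b x : quo_scale a (quo_scale b x) = quo_scale (a * b) x.
Proof. by rewrite -(quo_piK x) !quo_piZ scalerA. Qed.

Lemma quo_scale1 : left_id 1 quo_scale.
Proof. by move=> x; rewrite -(quo_piK x) quo_piZ scale1r. Qed.

Lemma quo_scaleDr : right_distributive quo_scale +%R.
Proof.
move=> a x y; rewrite -(quo_piK x) -(quo_piK y) [_ + _]quo_piD !quo_piZ.
by rewrite [RHS]quo_piD scalerDr.
Qed.

Lemma quo_scaleDl x : {morph quo_scale^~ x : a b / a + b}.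
Proof. by move=> a b; rewrite -(quo_piK x) !quo_piZ [RHS]quo_piD scalerDl. Qed.

HB.instance Definition _ := GRing.Zmodule_isLmodule.Build S quotient
  quo_scaleA quo_scale1 quo_scaleDr quo_scaleDl.

Lemma quo_pi_linear : linear quo_pi.
Proof. by move=> a u v; rewrite -quo_piD -quo_piZ. Qed.
End Quotient.

Lemma quo_exists (S : pzRingType) (V : lmodType S) (Q : V -> Prop) :
  submodule Q ->
  exists (W : lmodType S) (p : {linear V -> W}),
    surj p /\ forall v, p v = 0 <-> Q v.
Proof.
move=> subQ; exists (quotient subQ), (mklin (quo_pi_linear subQ)); split.
  by move=> x; exists (quo_val x); apply: quo_piK.
by move=> v; rewrite mklinE (quo_pi_eq subQ v 0) subr0.
Qed.

(** * Semi-Gorenstein-projective modules *)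

Section SemiGorenstein.
Variable S : pzRingType.
Implicit Types U V W P Z K : lmodType S.

(** When [V] is projective and [i] is injective, this says that Ext^1 of the cokernel with values in
    [S] vanishes. *)
Definition hom_extends U V (i : {linear U -> V}) : Prop :=
  forall h : {linear U -> S^o},
    exists k : {linear V -> S^o}, forall u, k (i u) = h u.

Definition ses U V W (i : {linear U -> V}) (p : {linear V -> W}) : Prop :=
  [/\ injective i, surj p & exact_at i p].

Definition splice_mod P (Q : nat -> lmodType S) (n : nat) : lmodType S :=
  if n is m.+1 then Q m else P.

Definition splice_map P (Q : nat -> lmodType S) (f : {linear Q 0%N -> P})
    (d : forall n, {linear Q n.+1 -> Q n}) (n : nat) :
    {linear splice_mod P Q n.+1 -> splice_mod P Q n} :=
  if n is m.+1 then d m else f.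

Lemma splice_resolution K P Z (i : {linear K -> P}) (p : {linear P -> Z})
    (Q : nat -> lmodType S) (d : forall n, {linear Q n.+1 -> Q n})
    (e : {linear Q 0%N -> K}) :
  ses i p -> projective P -> projective_resolution d e ->
  projective_resolution (splice_map (i \o e) d)
    (p : {linear splice_mod P Q 0 -> Z}).
Proof.
move=> [ii ps ip] projP [projQ es d0e dd]; split=> //; first by case.
  move=> v; split=> [/ip[u <-]|[x <-]]; last by apply/ip; exists (e x).
  by have [x <-] := es u; exists x.
case=> [|n]; last exact: dd.
move=> v; split=> [iev|/d0e /= ->]; last exact: linear0.
by apply/d0e; apply: ii; rewrite linear0.
Qed.

Lemma resolution_syzygy K Z (P : nat -> lmodType S)
    (d : forall n, {linear P n.+1 -> P n}) (e : {linear P 0%N -> Z})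
    (i : {linear K -> P 0%N}) :
  projective_resolution d e -> injective i -> exact_at i e ->
  exists e' : {linear P 1%N -> K}, (forall x, i (e' x) = d 0%N x) /\
    @projective_resolution S K (fun n => P n.+1) (fun n => d n.+1) e'.
Proof.
move=> [projP es d0e dd] ii ie.
have [|e' e'E] := factor_inj ii (f := d 0%N).
  by move=> w; apply/ie/d0e; exists w.
exists e'; split=> //; split=> // [k|].
- have /d0e[x dx] : e (i k) = 0 by apply/ie; exists k.
  by exists x; apply: ii; rewrite e'E.
- move=> v; split=> [e'v|].
    by apply/(dd 0%N); rewrite -e'E e'v linear0.
  by move=> /(dd 0%N); rewrite -e'E => iev; apply: ii; rewrite linear0.
Qed.

Lemma hom_exact_atP U V W (f : {linear U -> V}) (g : {linear V -> W})
    (Q : lmodType S) :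
  (forall u, g (f u) = 0) ->
  (forall h : {linear V -> Q}, (forall u, h (f u) = 0) ->
    exists k : {linear W -> Q}, forall v, k (g v) = h v) ->
  hom_exact_at f g Q.
Proof. by move=> gf H h; split=> [/H//|[k kg] u]; rewrite -kg gf linear0. Qed.

(** Lift the maps to the projectives as [a0], [b0], [u0]. Then [x - b0 (a0 x) - u0 (v (e x))] lies
    in the kernel of [e], which gives [w]; on [K'] the last term vanishes. *)
Lemma retract_mod_projective_syzygy K P Z Z' (Q : lmodType S)
    (i : {linear K -> P}) (p : {linear P -> Z})
    (a : {linear Z' -> Z}) (b : {linear Z -> Z'})
    (v : {linear Z' -> Q}) (u : {linear Q -> Z'})
    (K' P' : lmodType S) (i' : {linear K' -> P'}) (e : {linear P' -> Z'}) :
  ses i p -> projective P -> projective Q -> projective P' -> ses i' e ->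
  (forall z, z - b (a z) = u (v z)) ->
  exists (a0 : {linear P' -> P}) (a' : {linear K' -> K}) (b' : {linear K -> K'})
    (w : {linear P' -> K'}),
    (forall k, i (a' k) = a0 (i' k)) /\ (forall k, k - b' (a' k) = w (i' k)).
Proof.
move=> [ii ps ip] projP projQ projP' [ii' es ie'] ab.
have [a0 a0E] := projP' _ _ p (a \o e) ps.
have [b0 b0E] := projP _ _ e (b \o p) es.
have [u0 u0E] := projQ _ _ e u es.
rewrite /= in a0E b0E.
have ei' k : e (i' k) = 0 by apply/ie'; exists k.
have pi k : p (i k) = 0 by apply/ip; exists k.
have [|a' a'E] := factor_inj ii (f := a0 \o i').
  by move=> k; apply/ip; rewrite /= a0E ei' linear0.
have [|b' b'E] := factor_inj ii' (f := b0 \o i).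
  by move=> k; apply/ie'; rewrite /= b0E pi linear0.
rewrite /= in a'E b'E.
have [|w wE] := factor_inj ii' (f := idfun \- (b0 \o a0) \- (u0 \o (v \o e))).
  by move=> x; apply/ie'; rewrite /= !linearB /= b0E a0E u0E -ab subrr.
exists a0, a', b', w; split=> // k.
by apply: ii'; rewrite wE /= linearB b'E a'E ei' (linear0 v) (linear0 u0) subr0.
Qed.

(** * A coinductive criterion for semi-Gorenstein-projective modules *)

Section Coinduction.
Variable C : lmodType S -> Prop.
Hypothesis C_step : forall Z, C Z ->
  exists K P (i : {linear K -> P}) (p : {linear P -> Z}),
    [/\ C K, projective P, ses i p & hom_extends i].

(* The statement allows [Z'] to be a retract of [Z] up to maps factoring through
   a projective, because syzygies of one module in two different resolutions
   are only related in this way. *)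
Lemma Ext_eq0_retract n : forall Z Z' (Q : lmodType S)
    (a : {linear Z' -> Z}) (b : {linear Z -> Z'})
    (v : {linear Z' -> Q}) (u : {linear Q -> Z'}),
  C Z -> projective Q -> (forall z, z - b (a z) = u (v z)) ->
  Ext_eq0 n.+1 Z' S^o.
Proof.
elim: n => [|n IH] Z Z' Q a b v u /C_step[K [P [i [p [CK projP ses_ip ext]]]]];
  move=> projQ ab P' d e res; have [projP' es d0e dd] := res;
  have [K' [i' [ii' ie']]] := ker_exists e;
  have [e' [e'E res']] := resolution_syzygy res ii' ie';
  have [a0 [a' [b' [w [a0E wE]]]]] :=
    retract_mod_projective_syzygy ses_ip projP projQ (projP' 0%N)
      (And3 ii' es ie') ab.
  have [_ e's d1e' _] := res'.
  apply: hom_exact_atP => [x|h hd]; first by apply/dd; exists x.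
  have [|g gE] := factor_surj (q := e') (f := h) e's.
    by move=> x /d1e'[y <-]; apply: hd.
  (* The cocycle [h] descends to [g] on [K']. Only its part [g \o b' \o a'], which passes through
     [K], has to be extended; the defect is [g \o w \o i'], already defined on [P']. *)
  have [k kE] := ext (g \o b').
  exists ((k \o a0) \+ (g \o w)) => x /=.
  rewrite -gE -e'E -a0E kE /= -wE -linearD.
  by rewrite addrC subrK.
exact: (IH K K' (P' 0%N) a' b' i' w CK (projP' 0%N) wE _ _ _ res').
Qed.

(** [Z] is a retract of itself. Each step of the class kills one Ext^1 and shifts the degree to a
    syzygy in the class. *)
Lemma semi_gp_coind Z : C Z -> semi_gorenstein_projective Z.
Proof.
move=> CZ [//|n] _.
have [K [P [_ [_ [_ projP _ _]]]]] := C_step CZ.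
apply: (@Ext_eq0_retract n Z Z P idfun idfun \0 \0 CZ projP) => z.
by rewrite /= subrr.
Qed.
End Coinduction.
End SemiGorenstein.

(** * Weakly Gorenstein rings and torsionless modules *)

Section WeaklyGorenstein.
Variable S : pzRingType.
Implicit Types U V W P Z K Q : lmodType S.

Definition noetherian_ring : Prop := forall U V (i : {linear U -> V}),
  injective i -> finitely_generated V -> finitely_generated U.

Definition left_approximations : Prop := forall Z, finitely_generated Z ->
  exists r (f : {linear Z -> 'rV[S]_r}), hom_extends f.

Definition torsionless Z : Prop :=
  forall z : Z, z <> 0 -> exists h : {linear Z -> S^o}, h z <> 0.

Lemma hom_extends_torsionless U V (i : {linear U -> V}) :
  hom_extends i -> torsionless U -> injective i.
Proof.
move=> exti tlU; apply: ker_inj => u iu0; apply: contrapT => /tlU[h []].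
by have [g <-] := exti h; rewrite iu0 linear0.
Qed.

(** Both the sequence and its dual are exact; such sequences can be spliced into complete
    resolutions. *)
Definition good_ses U W : Prop :=
  exists k (i : {linear U -> 'rV[S]_k}) (p : {linear 'rV[S]_k -> W}),
    ses i p /\ hom_extends i.

Lemma coord_exists k (j : 'I_k) :
  exists f : {linear 'rV[S]_k -> S^o}, forall v, f v = v 0 j.
Proof.
have lf : linear (fun v : 'rV[S]_k => v 0 j : S^o) by move=> a u v;
  rewrite !mxE.
by exists (mklin lf).
Qed.

Lemma lin_comb_exists V W k (f : 'I_k -> {linear V -> S^o}) (g : 'I_k -> W) :
  exists h : {linear V -> W}, forall v, h v = \sum_j (f j v : S) *: g j.
Proof.
have lh : linear (fun v => \sum_j (f j v : S) *: g j).
  move=> a u v; rewrite scaler_sumr -big_split; apply: eq_bigr => j _.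
  by rewrite linearP scalerDl scalerA.
by exists (mklin lh).
Qed.

Lemma dual_basis Q : finitely_generated Q -> projective Q ->
  exists k (g : 'I_k -> Q) (f : 'I_k -> {linear Q -> S^o}),
    forall q, q = \sum_j (f j q : S) *: g j.
Proof.
move=> /fg_surj[k [p ps]] projQ; have [t tE] := projQ _ _ p idfun ps.
have [c cE] := choice (@coord_exists k).
exists k, (fun j => p (delta_mx 0 j)), (fun j => c j \o t) => q.
rewrite -[LHS](tE q) (lin_row p); apply: eq_bigr => j _.
by rewrite /= cE.
Qed.

Lemma dual_basis_torsionless Q : finitely_generated Q -> projective Q ->
  torsionless Q.
Proof.
move=> fgQ /(dual_basis fgQ)[k [g [f fE]]] z z0; apply: contrapT => noh.
apply: z0; rewrite (fE z) big1 // => j _.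
have [->|fz] := eqVneq (f j z) 0; first by rewrite scale0r.
by case: noh; exists (f j); apply/eqP.
Qed.

Lemma hom_extends_projective U V (i : {linear U -> V}) Q :
  hom_extends i -> finitely_generated Q -> projective Q ->
  forall h : {linear U -> Q},
    exists k : {linear V -> Q}, forall u, k (i u) = h u.
Proof.
move=> exti fgQ projQ h; have [m [g [f fE]]] := dual_basis fgQ projQ.
have [k kE] := choice (fun j => exti (f j \o h)).
have [k' k'E] := lin_comb_exists k g; exists k' => u.
by rewrite k'E [RHS]fE; apply: eq_bigr => j _; rewrite kE.
Qed.

(** The complex is spliced from the middle terms. A cocycle on [P (i + 1)] descends along
    [p (i + 1)] to [G (i + 1 + 1)] and extends from there to the next term. *)
Lemma good_ses_gorenstein_projective (G : int -> lmodType S) :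
  (forall i, good_ses (G i) (G (i + 1))) -> gorenstein_projective (G 0).
Proof.
move=> goodG.
pose data i := {k : nat &
  {f : {linear G i -> 'rV[S]_k} & {p : {linear 'rV[S]_k -> G (i + 1)} |
  ses f p /\ hom_extends f}}}.
have D i : data i.
  have [k Hk] := cid (goodG i); have [f Hf] := cid Hk; have [p Hp] := cid Hf.
  by exists k, f, p.
pose P i := 'rV[S]_(projT1 (D i)) : lmodType S.
pose f i : {linear G i -> P i} := projT1 (projT2 (D i)).
pose p i : {linear P i -> G (i + 1)} := sval (projT2 (projT2 (D i))).
have fp i : ses (f i) (p i) /\ hom_extends (f i) :=
  svalP (projT2 (projT2 (D i))).
have fI i : injective (f i) by have [[]] := fp i.
have pS i : surj (p i) by have [[]] := fp i.
have fpE i : exact_at (f i) (p i) by have [[]] := fp i.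
exists P, (fun i => f (i + 1) \o p i); split.
- by move=> i; split; [apply: row_fg | apply: row_projective].
- move=> i v; split=> /= [fpv|[x <-]].
    have /fpE[u <-] : p (i + 1) v = 0 by apply: (fI _); rewrite fpv linear0.
    by have [x <-] := pS i u; exists x.
  by have -> : p (i + 1) (f (i + 1) (p i x)) = 0; [apply/fpE;
    exists (p i x) | rewrite linear0].
- move=> Q fgQ projQ i; apply: hom_exact_atP => [x|h hd] /=.
    by have -> : p (i + 1) (f (i + 1) (p i x)) = 0; [apply/fpE;
      exists (p i x) | rewrite linear0].
  have [|g gE] := factor_surj (q := p (i + 1)) (f := h) (pS _).
    by move=> v /fpE[u <-]; have [x <-] := pS i u; apply: hd.
  have [_ ext] := fp (i + 1 + 1).
  have [k kE] := hom_extends_projective ext fgQ projQ g.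
  by exists k => v; rewrite /= kE.
exists (f 0); split; first exact: fI.
move=> x; split=> [/= fpx|[g <-]]; first by apply/fpE; apply: (fI _);
  rewrite fpx linear0.
by rewrite /=; have -> : p 0 (f 0 g) = 0; [apply/fpE;
  exists g | rewrite linear0].
Qed.

Lemma lwg_torsionless : left_weakly_gorenstein S ->
  forall Z, finitely_generated Z -> semi_gorenstein_projective Z ->
    torsionless Z.
Proof.
move=> wg Z fgZ sgZ z z0; have [P [d [fgP _ _ [j [ji _]]]]] := wg Z fgZ sgZ.
have [|||h hz] := dual_basis_torsionless (Q := P 0) _ _ (z := j z).
- by have [] := fgP 0.
- by have [] := fgP 0.
- by move=> jz; apply: z0; apply: ji; rewrite linear0.
by exists (h \o j).
Qed.

(** Ext^1 of [Z] vanishes by [exti], and higher degrees shift to [K]. The coinductive class [C]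
    adjoins the cokernels of such maps from [K] to [P]. *)
Lemma semi_gp_extension K P Z (i : {linear K -> P}) (p : {linear P -> Z}) :
  (forall Z', finitely_generated Z' -> semi_gorenstein_projective Z' ->
    exists K', [/\ finitely_generated K', semi_gorenstein_projective K'
      & good_ses K' Z']) ->
  finitely_generated K -> semi_gorenstein_projective K ->
  projective P -> ses i p -> hom_extends i -> semi_gorenstein_projective Z.
Proof.
move=> syz fgK sgK projP ses_ip exti.
pose C W := (finitely_generated W /\ semi_gorenstein_projective W) \/
  exists i' : {linear K -> P},
    exists2 p' : {linear P -> W}, ses i' p' & hom_extends i'.
apply: (@semi_gp_coind S C); last by right; exists i, p.
move=> W [[fgW sgW]|[i' [p' ses' ext']]]; last by exists K, P, i', p';
  split=> //; left.
have [K' [fgK' sgK' [k [i' [p' [ses' ext']]]]]] := syz W fgW sgW.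
by exists K', 'rV[S]_k, i', p'; split=> //; [left | apply: row_projective].
Qed.

Hypothesis noethS : noetherian_ring.

Record free_cover Z := FreeCover {
  cov_ker : lmodType S; cov_rank : nat;
  cov_inc : {linear cov_ker -> 'rV[S]_cov_rank};
    cov_map : {linear 'rV[S]_cov_rank -> Z};
  cov_fg : finitely_generated cov_ker; cov_ses : ses cov_inc cov_map }.

Lemma free_cover_exists Z : finitely_generated Z -> inhabited (free_cover Z).
Proof.
move=> /fg_surj[k [p ps]]; have [K [i [ii ip]]] := ker_exists p.
by split; apply: (@FreeCover Z K k i p);
  [apply: noethS ii (row_fg _ _) | split].
Qed.

(** [Ext_eq0] quantifies over all projective resolutions, so its vanishing can be exploited only
    once one is at hand. *)
Lemma free_resolution_exists Z : finitely_generated Z ->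
  exists (P : nat -> lmodType S) (d : forall n, {linear P n.+1 -> P n})
    (e : {linear P 0%N -> Z}), projective_resolution d e.
Proof.
move=> fgZ; pose X := {Z : lmodType S | finitely_generated Z}.
have cov (x : X) : free_cover (sval x).
  by have /cid[] : exists _ : free_cover (sval x), True;
    [have [c] := free_cover_exists (svalP x); exists c | move=> c _; exact: c].
pose nxt (x : X) : X := exist _ (cov_ker (cov x)) (cov_fg (cov x)).
pose z n := iter n nxt (exist _ Z fgZ).
pose P n := 'rV[S]_(cov_rank (cov (z n))) : lmodType S.
pose d n : {linear P n.+1 -> P n} :=
  cov_inc (cov (z n)) \o cov_map (cov (z n.+1)).
exists P, d, (cov_map (cov (z 0%N))); split.
- by move=> n; apply: row_projective.
- by have [] := cov_ses (cov (z 0%N)).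
- have [_ _ ex] := cov_ses (cov (z 0%N));
  have [_ s _] := cov_ses (cov (z 1%N)) => v.
  split=> [/ex[u <-]|[x <-]]; last by apply/ex;
    exists (cov_map (cov (z 1%N)) x).
  by have [x <-] := s u; exists x.
move=> n v; have [_ _ ex] := cov_ses (cov (z n.+1)).
have [_ s _] := cov_ses (cov (z n.+2)); have [ii _ _] := cov_ses (cov (z n)).
split=> [dv|[x <-]].
  have /ex[u <-] : cov_map (cov (z n.+1)) v = 0.
    by apply: (ii); rewrite linear0.
  by have [x <-] := s u; exists x.
rewrite /= [X in cov_inc _ X](_ : _ = 0) ?linear0 //.
by apply/ex; exists (cov_map (cov (z n.+2)) x).
Qed.

(** Splice a resolution of [K] with the cover of [Z]: positive degrees for [K] are degrees at least
    two for [Z], and degree one says that functionals on [K] extend to the free module. *)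
Lemma semi_gp_syzygy Z : finitely_generated Z -> semi_gorenstein_projective Z ->
  exists K, [/\ finitely_generated K, semi_gorenstein_projective K
    & good_ses K Z].
Proof.
move=> fgZ sgZ; have [[K k i p fgK ses_ip]] := free_cover_exists fgZ.
have projk := @row_projective S k.
exists K; split=> //.
  case=> // n _ P d e res.
  exact: (sgZ n.+2 isT _ _ _ (splice_resolution ses_ip projk res)).
exists k, i, p; split=> // h.
have [P [d [e res]]] := free_resolution_exists fgK.
have [_ es d0e _] := res.
have [ext _] := sgZ 1%N isT _ _ _ (splice_resolution ses_ip projk res) (h \o e).
have [x|g gE] := ext.
  by rewrite /= (_ : e (d 0%N x) = 0) ?linear0 //; apply/d0e; exists x.
by exists g => u; have [x <-] := es u; apply: gE.
Qed.

Hypothesis approxS : left_approximations.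

(** As [Z] is torsionless, its left approximation [f] is injective; the approximation property makes
    Ext^1 of the cokernel vanish. *)
Lemma semi_gp_cosyzygy Z : finitely_generated Z ->
  semi_gorenstein_projective Z ->
  torsionless Z ->
  exists W, [/\ finitely_generated W, semi_gorenstein_projective W
    & good_ses Z W].
Proof.
move=> fgZ sgZ tlZ; have [r [f extf]] := approxS fgZ.
have fi := hom_extends_torsionless extf tlZ.
have [|W [p [ps pE]]] := @quo_exists S 'rV[S]_r (fun v => exists z, f z = v).
  split; first by exists 0; rewrite linear0.
    by move=> _ _ [u <-] [v <-]; exists (u + v); rewrite linearD.
  by move=> a _ [v <-]; exists (a *: v); rewrite linearZ.
exists W; have ses_fp : ses f p by [].
split; last by exists r, f, p.
  exact: fg_image (row_fg _ _) ps.
exact: semi_gp_extension (@semi_gp_syzygy) fgZ sgZ (@row_projective S r) ses_fp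
  extf.
Qed.

Lemma torsionless_lwg :
  (forall Z, finitely_generated Z -> semi_gorenstein_projective Z ->
    torsionless Z) ->
  left_weakly_gorenstein S.
Proof.
move=> tl Z fgZ sgZ.
pose X := {Z : lmodType S |
  finitely_generated Z /\ semi_gorenstein_projective Z}.
have [L LE] : {L : X -> X & forall x, good_ses (sval (L x)) (sval x)}.
  apply: (@choice X X (fun x y => good_ses (sval y) (sval x))) =>
    -[Y [fgY sgY]].
  have [K [fgK sgK gK]] := semi_gp_syzygy fgY sgY.
  by exists (exist _ K (conj fgK sgK)).
have [C CE] : {C : X -> X & forall x, good_ses (sval x) (sval (C x))}.
  apply: (@choice X X (fun x y => good_ses (sval x) (sval y))) =>
    -[Y [fgY sgY]].
  have [W [fgW sgW gW]] := semi_gp_cosyzygy fgY sgY (tl Y fgY sgY).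
  by exists (exist _ W (conj fgW sgW)).
pose x0 : X := exist _ Z (conj fgZ sgZ).
(* Cosyzygies continue [Z] to the right and syzygies to the left. [Negz n] is [-(n + 1)], hence the
   iterate [n.+1] of [L]. *)
pose G (i : int) : lmodType S :=
  match i with Posz n => sval (iter n C x0) | Negz n =>
    sval (iter n.+1 L x0) end.
apply: (@good_ses_gorenstein_projective G) => -[n|[|n]].
- by rewrite -PoszD addn1; apply: CE.
- exact: LE.
- by rewrite (_ : Negz n.+1 + 1 = Negz n);
  [apply: LE | rewrite !NegzE -addn1 PoszD opprD subrK].
Qed.
End WeaklyGorenstein.

(** * Artin algebras are noetherian *)

Section Span.
Variables (S : pzRingType) (V : lmodType S).
Implicit Types (s t : seq V) (u v x : V) (K : V -> Prop).

Definition span s v : Prop :=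
  forall K, submodule K -> (forall x, x \in s -> K x) -> K v.

Definition fg_sub K : Prop :=
  exists s, (forall x, x \in s -> K x) /\ forall v, K v -> span s v.

Lemma span_submodule s : submodule (span s).
Proof.
split=> [K sK _|u v su sv K sK Ks|a v sv K sK Ks]; first by case: sK.
  by apply: (submodD sK); [apply: su | apply: sv].
by apply: (submodZ sK); apply: sv.
Qed.

Lemma mem_span s x : x \in s -> span s x.
Proof. by move=> sx K _; apply. Qed.

Lemma span_trans s t v : (forall x, x \in s -> span t x) -> span s v ->
  span t v.
Proof. by move=> st; apply=> //; apply: span_submodule. Qed.

Lemma sub_span s t v : {subset s <= t} -> span s v -> span t v.
Proof. by move=> st; apply: span_trans => x /st; apply: mem_span. Qed.

Lemma span_nil v : span [::] v -> v = 0.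
Proof.
move/(_ (fun v => v = 0)); apply=> //.
by split=> // [u w -> ->|a u ->]; rewrite ?addr0 ?scaler0.
Qed.

Lemma span_cons x s v : span (x :: s) v -> exists c, span s (v - c *: x).
Proof.
have sS := span_submodule s.
move/(_ (fun v => exists c, span s (v - c *: x))); apply=> [|y]; first split.
- by exists 0; rewrite scale0r subr0; apply: (submod0 sS).
- move=> u w [c su] [d sw]; exists (c + d).
  by rewrite scalerDl opprD addrACA; apply: (submodD sS).
- move=> a u [c su]; exists (a * c).
  by rewrite -scalerA -scalerBr; apply: (submodZ sS).
rewrite inE => /predU1P[->|sy]; last by exists 0; rewrite scale0r subr0;
  apply: mem_span.
by exists 1; rewrite scale1r subrr; apply: (submod0 sS).
Qed.

Lemma span_coef s v :
  span s v -> exists c : nat -> S, v = \sum_(k < size s) c k *: s`_k.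
Proof.
move/(_ (fun v => exists c : nat -> S, v = \sum_(k < size s) c k *: s`_k)).
apply=> [|x sx]; first split.
- by exists (fun=> 0); rewrite big1 // => k _; rewrite scale0r.
- move=> _ _ [c ->] [d ->]; exists (fun k => c k + d k).
  by rewrite -big_split; apply: eq_bigr => k _; rewrite scalerDl.
- move=> a _ [c ->]; exists (fun k => a * c k).
  by rewrite scaler_sumr; apply: eq_bigr => k _; rewrite scalerA.
exists (fun k => (k == index x s)%:R).
have ls : (index x s < size s)%N by rewrite index_mem.
rewrite (bigD1 (Ordinal ls)) //= eqxx scale1r nth_index // big1 ?addr0 // => k.
by rewrite -val_eqE /= => /negPf ->; rewrite scale0r.
Qed.

End Span.

(** * Commutative artinian rings are noetherian *)

Section Hopkins.
Variable R : comPzRingType.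
Hypothesis artR : artinian R.
Implicit Types I J : R -> Prop.

Let ideal I := @submodule R R^o I.
Let fgI I := @fg_sub R R^o I.

Lemma ideal_minimal (Q : (R -> Prop) -> Prop) I : ideal I -> Q I ->
  exists J, [/\ ideal J, Q J & forall J', ideal J' -> Q J' ->
    (forall x, J' x -> J x) -> forall x, J x -> J' x].
Proof.
move=> idI QI; apply: contrapT => nomin.
pose X := {J | ideal J /\ Q J}.
have [f fE] : {f : X -> X & forall J : X,
    (forall x, sval (f J) x -> sval J x) /\
    ~ forall x, sval J x -> sval (f J) x}.
  apply: (@choice X X (fun J J' : X => (forall x, sval J' x -> sval J x) /\
    ~ forall x, sval J x -> sval J' x)) => -[J [idJ QJ]].
  apply: contrapT => noJ'; apply: nomin; exists J; split=> // J' idJ' QJ' sub.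
  apply: contrapT => nsub; apply: noJ'.
  by exists (exist _ J' (conj idJ' QJ')).
pose it n := iter n f (exist _ I (conj idI QI)).
have [||n nE] := artR (I := fun n => sval (it n)).
- by move=> n; have [[J0 JD JZ] _] := svalP (it n); split=> // a x; apply: JZ.
- by move=> n x; apply: (fE _).1.
by apply: (fE (it n)).2; apply: (nE n.+1).
Qed.

Lemma artinian_pow (x : R) : exists n d, x ^+ n = x ^+ n.+1 * d.
Proof.
have [||n nE] := artR (I := fun n y => exists d, y = x ^+ n * d).
- move=> n; split; first by exists 0; rewrite mulr0.
    by move=> _ _ [c ->] [d ->]; exists (c + d); rewrite mulrDr.
  by move=> a _ [d ->]; exists (a * d); rewrite mulrCA.
- by move=> n _ [d ->]; exists (x * d); rewrite mulrA -exprSr.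
have [|d dE] := nE n.+1 (leqnSn n) (x ^+ n); first by exists 1; rewrite mulr1.
by exists n, d.
Qed.

(* In a minimal ideal [I] that is not finitely generated, each [x] annihilates
   [I] or satisfies [x I = I], so [I] is a vector space over the field
   [R / ann I]; the spans of the tails of an infinite independent sequence in
   [I] would then decrease strictly. *)
Lemma artinian_fg_ideal I : ideal I -> fgI I.
Proof.
move=> idI0; apply: contrapT => nfgI0.
have {idI0 nfgI0 I}[I [idI nfgI minI]] :=
  ideal_minimal (Q := fun I => ~ fgI I) idI0 nfgI0.
have fgsub J : ideal J -> (forall y, J y -> I y) -> ~ (forall y, I y -> J y) ->
  fgI J.
  by move=> idJ JI nIJ; apply: contrapT => nfgJ; apply: nIJ; apply: minI.
(* If both alternatives fail, [x I] and the annihilator of [x] in [I] are proper subideals, hence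
   finitely generated; lifts [s'] for the former and generators [t] of the latter then generate
   [I]. *)
have dich x : (forall y, I y -> x * y = 0) \/ forall y, I y ->
  exists2 z, I z & y = x * z.
  apply: contrapT => /not_orP[nx0 nxI]; apply: nfgI.
  have [|||s [sI ss]] := fgsub (fun y => exists2 z, I z & y = x * z).
  - split; first by exists 0; rewrite ?mulr0 //; case: idI.
      move=> _ _ [z Iz ->] [w Iw ->]; exists (z + w); last by rewrite mulrDr.
      exact: (submodD idI).
    by move=> a _ [z Iz ->]; exists (a * z);
      [apply: (submodZ idI) | apply: mulrCA].
  - by move=> _ [z Iz ->]; apply: (submodZ idI).
  - by [].
  have [|||t [tI ts]] := fgsub (fun y => I y /\ x * y = 0).
  - split; first by split; [case: idI | rewrite mulr0].
      move=> y z [Iy xy] [Iz xz]; split; first exact: (submodD idI).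
      by rewrite mulrDr xy xz addr0.
    move=> a y [Iy xy]; split; first exact: (submodZ idI).
    by rewrite [a *: y]/(a * y) mulrCA xy mulr0.
  - by move=> y [].
  - by move=> IJ; apply: nx0 => y /IJ[].
  have [s' [s'I s's]] : exists s', (forall y, y \in s' -> I y) /\
      forall y, @span R R^o s y -> exists2 z, @span R R^o s' z & y = x * z.
    elim: s sI {ss} => [|y s IHs] sI.
      exists [::]; split=> // y /span_nil ->.
      by exists 0; [apply: (submod0 (span_submodule _)) | rewrite mulr0].
    have [|s' [s'I s's]] := IHs; first by move=> z sz; apply: sI;
      rewrite inE sz orbT.
    have [|z Iz yE] := sI y; first exact: mem_head.
    exists (z :: s'); split=> [w|w /span_cons[c /s's[v sv wE]]].
      by rewrite inE => /predU1P[->//|/s'I].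
    exists (c * z + v); last first.
      by apply/eqP; rewrite mulrDr -wE mulrCA -yE addrC subrK.
    apply: (submodD (span_submodule _)).
      by apply: (submodZ (span_submodule _)); apply: mem_span; apply: mem_head.
    by apply: sub_span sv => u; rewrite inE orbC => ->.
  exists (s' ++ t); split=> [y|y Iy].
    by rewrite mem_cat => /orP[/s'I//|/tI[]].
  have [|z sz yz] := s's (x * y); first by apply: ss; exists y.
  rewrite -[y](subrK z); apply: (submodD (span_submodule _)).
    apply: (@sub_span _ _ t) => [u tu|]; first by rewrite mem_cat tu orbT.
    apply: ts; split; last by rewrite mulrBr yz subrr.
    apply: (submodB idI) => //; apply: sz => //; exact: idI.
  by apply: sub_span sz => u su; rewrite mem_cat su.
(* Here [I = x ^+ n I], and on it [x ^+ n = x ^+ n.+1 * d] makes [d] inverse to [x]. *)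
have inv x : ~ (forall y, I y -> x * y = 0) -> exists d, forall y, I y ->
  d * (x * y) = y.
  move=> nx0; have [//|xI] := dich x; have [n [d dE]] := artinian_pow x.
  exists d => y Iy; have {xI Iy}[z Iz ->] : exists2 z, I z & y = x ^+ n * z.
    elim: n {dE} => [|n [z Iz ->]]; first by exists y; rewrite ?mul1r.
    by have [w Iw ->] := xI z Iz; exists w; rewrite // mulrA -exprSr.
  by rewrite {2}dE exprS !mulrA [d * x]mulrC -!mulrA [d * (_ * _)]mulrCA.
have [f fE] : {f : seq R -> R & forall s, (forall y, y \in s -> I y) ->
    I (f s) /\ ~ @span R R^o s (f s)}.
  apply: (@choice _ _ (fun s y =>
    (forall y, y \in s -> I y) -> I y /\ ~ @span R R^o s y)) => s.
  have [sI|] := pselect (forall y, y \in s -> I y); last by exists 0.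
  apply: contrapT => nos; apply: nfgI; exists s; split=> // v Iv.
  by apply: contrapT => nsv; apply: nos; exists v.
pose pre n := iter n (fun s => rcons s (f s)) [::].
pose x n := f (pre n).
have preE n : pre n = map x (iota 0 n).
  elim: n => // n IHn; rewrite [LHS](_ : _ = rcons (pre n) (x n)) //.
  by rewrite -[n.+1]addn1 iotaD map_cat -IHn cats1.
have preI n : forall y, y \in pre n -> I y.
  elim: n => // n IHn y; rewrite /= mem_rcons inE => /predU1P[->|/IHn//].
  by have [] := fE _ IHn.
have xI n : I (x n) by have [] := fE _ (preI n).
have xN n : ~ @span R R^o (map x (iota 0 n)) (x n).
  by rewrite -preE; have [] := fE _ (preI n).
have iota_sub n m k l : (k <= n)%N -> (n + m <= k + l)%N ->
    {subset map x (iota n m) <= map x (iota k l)}.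
  move=> kn nmkl y /mapP[i]; rewrite mem_iota => /andP[ni inm] ->.
  by apply: map_f; rewrite mem_iota (leq_trans kn ni) (leq_trans inm nmkl).
(* The chain of tail spans: stationary at [n], it expresses [x n] by later terms. *)
have [||n nE] := artR (I :=
  fun n y => exists m, @span R R^o (map x (iota n m)) y).
- move=> n; split; first by exists 0%N; apply: (submod0 (span_submodule _)).
    move=> y z [m sy] [l sz]; exists (m + l)%N;
      apply: (submodD (span_submodule _)).
      by apply: sub_span sy; apply: iota_sub => //; rewrite leq_add2l leq_addr.
    by apply: sub_span sz; apply: iota_sub => //; rewrite leq_add2l leq_addl.
  by move=> a y [m sy]; exists m; apply: (submodZ (span_submodule _)).
- by move=> n y [m sy]; exists m.+1; apply: sub_span sy; apply: iota_sub;
  rewrite ?addSnnS.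
have [|m] := nE n.+1 (leqnSn n) (x n).
  by exists 1%N; apply: mem_span; rewrite /= mem_head.
(* Shorten the relation from the end. Either its last coefficient [c] annihilates [I] and the term
   drops out, or [c] is invertible on [I] and the last element lies in the span of its
   predecessors. *)
elim: m => [|m IHm] sx.
  by apply: (xN n); rewrite (span_nil sx); apply: (submod0 (span_submodule _)).
have {sx}/span_cons[c sx] : @span R R^o (x (n.+1 + m)%N :: map x (iota n.+1 m))
  (x n).
  apply: sub_span sx => y; rewrite -[m.+1]addn1 iotaD map_cat mem_cat !inE orbC
    //.

have [c0|/inv[d dE]] := pselect (forall y, I y -> c * y = 0).
  by apply: IHm; move: sx; rewrite [c *: _](c0 _ (xI _)) subr0.
apply: (xN (n.+1 + m)%N); rewrite -(dE _ (xI _)).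
apply: (submodZ (span_submodule _)).
rewrite -[c * _](subKr (x n)); apply: (submodB (span_submodule _)).
  by apply: mem_span; apply: map_f;
    rewrite mem_iota /= add0n addSn ltnS leq_addr.
by apply: sub_span sx; apply: iota_sub.
Qed.
End Hopkins.

(** * Restriction of scalars *)

Section Pullback.
Variables (S T : pzRingType) (f : {additive S -> T}) (V : lmodType T).
Variables (fM : {morph f : a b / a * b}) (f1 : forall v : V, f 1 *: v = v).

(* [f] need not preserve the unit of the ring: it only has to act as the
   identity of [V]. *)
Definition pullback (_ : {morph f : a b / a * b})
  (_ : forall v : V, f 1 *: v = v) : Type := V.
Local Notation VS := (pullback fM f1).

HB.instance Definition _ := GRing.Zmodule.on VS.

Definition pullback_scale (a : S) (v : VS) : VS := f a *: (v : V).

Lemma pullback_scaleA a b v : pullback_scale a (pullback_scale b v) =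
  pullback_scale (a * b) v.
Proof. by rewrite /pullback_scale scalerA fM. Qed.
Lemma pullback_scale1 : left_id 1 pullback_scale.
Proof. by move=> v; apply: f1. Qed.
Lemma pullback_scaleDr : right_distributive pullback_scale +%R.
Proof. by move=> a u v; apply: scalerDr. Qed.
Lemma pullback_scaleDl v : {morph pullback_scale^~ v : a b / a + b}.
Proof. by move=> a b; rewrite /pullback_scale raddfD scalerDl. Qed.

HB.instance Definition _ := GRing.Zmodule_isLmodule.Build S VS
  pullback_scaleA pullback_scale1 pullback_scaleDr pullback_scaleDl.
End Pullback.

(** * Submodules over a noetherian ring *)

Section NoetherianModules.
Variable R : pzRingType.
Hypothesis noethR : forall I : R -> Prop, @submodule R R^o I -> @fg_sub R R^o I.

(** Induction on the generators: [K] is generated by lifts [t'] of generators of the ideal [I] of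
    coefficients at [x], together with generators [t] of its part in the span of [s]. *)
Lemma fg_submodule (V : lmodType R) (s : seq V) : forall K : V -> Prop,
  submodule K -> (forall v, K v -> span s v) -> fg_sub K.
Proof.
elim: s => [|x s IHs] K subK Ks.
  by exists [::]; split.
have sS := span_submodule s.
pose I (c : R) := exists2 v, K v & span s (v - c *: x).
have [|cs [csI Ics]] := noethR (I := I).
  split; first by exists 0; rewrite ?scale0r ?subr0;
    [apply: (submod0 subK) | apply: (submod0 sS)].
    move=> c d [u Ku su] [v Kv sv]; exists (u + v); first exact: (submodD subK).
    by rewrite scalerDl opprD addrACA; apply: (submodD sS).
  move=> a c [u Ku su]; exists (a *: u); first exact: (submodZ subK).
  by rewrite -scalerA -scalerBr; apply: (submodZ sS).
have [|t [tK Kt]] := IHs (fun v => K v /\ span s v) _ (fun v => @proj2 _ _).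
  split; first by split; [apply: (submod0 subK) | apply: (submod0 sS)].
    by move=> u v [Ku su] [Kv sv]; split;
      [apply: (submodD subK) | apply: (submodD sS)].
  by move=> a u [Ku su]; split; [apply: (submodZ subK) | apply: (submodZ sS)].
have [t' [t'K cst']] : exists t', (forall y, y \in t' -> K y) /\
    forall c : R, @span R R^o cs c ->
      exists2 v, span t' v & span s (v - c *: x).
  elim: cs csI {Ics} => [|d cs IHcs] csI.
    exists [::]; split=> // c /span_nil ->; rewrite scale0r.
    by exists 0; rewrite ?subr0; apply: (submod0 (span_submodule _)).
  have [|t' [t'K cst']] := IHcs; first by move=> c sc; apply: csI;
    rewrite inE sc orbT.
  have [|u Ku su] := csI d; first exact: mem_head.
  exists (u :: t'); split=> [y|c /span_cons[a /cst'[v sv svc]]].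
    by rewrite inE => /predU1P[->|/t'K].
  exists (a *: u + v).
    apply: (submodD (span_submodule _)); last by apply: sub_span sv => y;
      rewrite inE orbC => ->.
    by apply: (submodZ (span_submodule _)); apply: mem_span; apply: mem_head.
  have := submodD sS (submodZ sS a su) svc.
  by rewrite scalerBr scalerBl scalerA opprB addrACA addKr.
exists (t' ++ t); split=> [y|v Kv].
  by rewrite mem_cat => /orP[/t'K//|/tK[]].
have /span_cons[c sc] := Ks v Kv.
have [|u t'u su] := cst' c; first by apply: Ics; exists v.
rewrite -[v](subrK u); apply: (submodD (span_submodule _)); last first.
  by apply: sub_span t'u => y t'y; rewrite mem_cat t'y.
apply: (@sub_span _ _ t) => [y ty|]; first by rewrite mem_cat ty orbT.
apply: Kt; split; first by apply: (submodB subK) => //; apply: t'u.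
by have := submodB sS sc su; rewrite opprB addrA subrK.
Qed.
End NoetherianModules.

(** * Artin algebras: noetherianity and left approximations *)

Section ArtinAlgebra.
Variables (R : comPzRingType) (S : pzRingType) (i : {rmorphism R -> S}).
Hypothesis artS : artin_algebra i.

Lemma rmorph_scale1 (V : lmodType S) (v : V) : i 1 *: v = v.
Proof. by rewrite rmorph1 scale1r. Qed.

Local Notation VR V := (pullback (rmorphM i) (@rmorph_scale1 V)).

Lemma restriction_spanned (V : lmodType S) : finitely_generated V ->
  exists s : seq (VR V), forall v, span s v.
Proof.
have [_ _ [sS gS]] := artS; case=> s gV.
exists [seq (a *: x : V) | x <- s, a <- sS] => v; have [c ->] := gV v.
apply: (submod_sum (span_submodule _)) => k.
have [d ->] := gS (c k); rewrite /idfun scaler_suml.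
apply: (submod_sum (span_submodule _)) => j.
rewrite -scalerA; apply: (@submodZ _ (VR V) _ (span_submodule _) (d j)).
by apply: mem_span; apply/allpairsP; exists (s`_k, sS`_j); split=> //;
  apply: mem_nth.
Qed.

(** Stability of [K] is asked under [R] only, since the value vectors of functionals on a module
    need not form an [S]-submodule. *)
Lemma restriction_fg_sub (V : lmodType S) (K : V -> Prop) :
  finitely_generated V -> (forall u v, K u -> K v -> K (u + v)) -> K 0 ->
  (forall r v, K v -> K (i r *: v)) -> @fg_sub R (VR V) K.
Proof.
move=> /restriction_spanned[s sV] KD K0 KZ; have [artR _ _] := artS.
by apply: (fg_submodule (artinian_fg_ideal artR) (s := s)).
Qed.

Lemma artin_algebra_noetherian : noetherian_ring S.
Proof.
move=> U V f fi fgV.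
have [|||s [sK Ks]] := restriction_fg_sub (K := fun v => exists u, f u = v) fgV.
- by move=> _ _ [u <-] [v <-]; exists (u + v); rewrite linearD.
- by exists 0; rewrite linear0.
- by move=> r _ [u <-]; exists (i r *: u); rewrite linearZ.
have [t tE] : exists t, s = map f t.
  elim: s sK {Ks} => [|x s IHs] sK; first by exists [::].
  have [|t ->] := IHs; first by move=> y sy; apply: sK; rewrite inE sy orbT.
  by have [|u <-] := sK x; [apply: mem_head | exists (u :: t)].
exists t => u; have [c cE] := span_coef (Ks (f u) (ex_intro _ u erefl)).
exists (fun k => i (c k)); apply: fi; rewrite cE linear_sum tE size_map.
by apply: eq_bigr => k _; rewrite (nth_map 0) // linearZ.
Qed.

(** The dual of [Z], embedded by values on generators, is finitely generated over [R]; its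
    generators [h] are the components of [f]. In an [R]-combination of them the central coefficients
    can be put on the right, where they define a left linear map on the free module. *)
Lemma artin_algebra_left_approximations : left_approximations S.
Proof.
move=> Z /fg_surj[k [p ps]]; have [_ iC _] := artS.
pose K (v : 'rV[S]_k) :=
    exists h : {linear Z -> S^o}, forall j, v 0 j = h (p (delta_mx 0 j)).
have [|||s [sK Ks]] := restriction_fg_sub (K := K) (row_fg S k).
- by move=> u v [g gE] [h hE]; exists (g \+ h) => j; rewrite mxE gE hE.
- by exists \0 => j; rewrite mxE.
- move=> r v [h hE].
  have lrh : linear (fun z => i r * h z : S^o).
    move=> a x y; rewrite linearP mulrDr; congr (_ + _).
    by rewrite /GRing.scale /= !mulrA iC.
  by exists (mklin lrh) => j; rewrite mxE hE.
have [h hE] := choice (fun m : 'I_(size s) => sK _ (mem_nth 0 (ltn_ord m))).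
have [f fE] := lin_comb_exists h (fun m => delta_mx 0 m : 'rV[S]_(size s)).
exists (size s), f => g.
have [|c cE] := span_coef (Ks (\row_j g (p (delta_mx 0 j))) _).
  by exists g => j; rewrite mxE.
have [g' g'E] := row_lin_exists (fun m : 'I_(size s) => i (c m) : S^o).
have fP z m : f z 0 m = h m z.
  rewrite fE summxE (bigD1 m) //= big1 ?addr0 => [|l ml];
    first by rewrite !mxE !eqxx mulr1.
  by rewrite !mxE eq_sym (negPf ml) andbF mulr0.
have gE j : g' (f (p (delta_mx 0 j))) = g (p (delta_mx 0 j)).
  rewrite g'E; transitivity ((\row_j g (p (delta_mx 0 j)) : 'rV[S]_k) 0 j);
    last by rewrite mxE.
  rewrite [\row_j _](cE : _ =
    \sum_(m < size s) i (c m) *: (s`_m : 'rV[S]_k)) summxE.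
  by apply: eq_bigr => m _; rewrite fP mxE hE iC.
exists g' => z; have [w <-] := ps z.
have /= -> := lin_row (g' \o f \o p) w; have /= -> := lin_row (g \o p) w.
by apply: eq_bigr => j _; rewrite /= gE.
Qed.
End ArtinAlgebra.

(** * Morita rings *)

(* The Morita ring up to isomorphism, in a form that is invariant under the
   exchange of [A] and [B]. *)
Record morita_coords (A B : pzRingType) (M : bimodType B A) (N : bimodType A B)
    (L : pzRingType) := MoritaCoords {
  mk : A -> N -> M -> B -> L;
  ca : {additive L -> A}; cn : {additive L -> N};
  cm : {additive L -> M}; cb : {additive L -> B};
  ca_mk : forall a n m b, ca (mk a n m b) = a;
  cn_mk : forall a n m b, cn (mk a n m b) = n;
  cm_mk : forall a n m b, cm (mk a n m b) = m;
  cb_mk : forall a n m b, cb (mk a n m b) = b;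
  coords_inj : forall x y, ca x = ca y -> cn x = cn y -> cm x = cm y ->
    cb x = cb y -> x = y;
  ca1 : ca 1 = 1; cb1 : cb 1 = 1;
  ca_mul : forall x y, ca (x * y) = ca x * ca y;
  cb_mul : forall x y, cb (x * y) = cb x * cb y;
  cn_mul : forall x y, cn (x * y) = ca x *: cn y + cn x *> cb y;
  cm_mul : forall x y, cm (x * y) = cm x *> ca y + cb x *: cm y }.

(** Transparent, because later proofs identify the exchanged coordinates with the original ones by
    conversion. *)
Definition swap_coords (A B : pzRingType) (M : bimodType B A)
  (N : bimodType A B)
    (L : pzRingType) (C : morita_coords M N L) : morita_coords N M L.
Proof.
apply: (@MoritaCoords B A N M L (fun b m n a =>
  mk C a n m b) (cb C) (cm C) (cn C) (ca C)).
- by move=> *; apply: cb_mk.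
- by move=> *; apply: cm_mk.
- by move=> *; apply: cn_mk.
- by move=> *; apply: ca_mk.
- by move=> x y eb em en ea; apply: (@coords_inj _ _ _ _ _ C).
- exact: cb1.
- exact: ca1.
- exact: cb_mul.
- exact: ca_mul.
- by move=> x y; rewrite cm_mul addrC.
- by move=> x y; rewrite cn_mul addrC.
Defined.

Lemma scale_regE (S : pzRingType) (a : S) (x : S^o) : a *: x = a * (x : S).
Proof. by []. Qed.

Lemma rscale0r (B A : pzRingType) (M : bimodType B A) (m : M) : m *> 0 = 0.
Proof. by apply: (@addrI _ (m *> 0)); rewrite -rscaleDr !addr0. Qed.

(** A basis in the sense of the dual basis lemma: the coordinates [rf j m] need not be unique. Their
    values generate the trace ideal of the right module. *)
Record right_basis (B A : pzRingType) (M : bimodType B A) (k : nat) :=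
  RightBasis {
  rb : 'I_k -> M; rf : 'I_k -> {additive M -> A};
  rfZ : forall j m a, rf j (m *> a) = rf j m * a;
  rbE : forall m, m = \sum_j rb j *> rf j m }.

Record left_basis (B A : pzRingType) (M : bimodType B A) (k : nat) :=
  LeftBasis {
  lb : 'I_k -> M; lf : 'I_k -> {additive M -> B};
  lfZ : forall j b m, lf j (b *: m) = b * lf j m;
  lbE : forall m, m = \sum_j lf j m *: lb j }.

Lemma right_basis_exists (B A : pzRingType) (M : bimodType B A) :
  finitely_generated (right_mod M) -> projective (right_mod M) ->
  exists k, inhabited (right_basis M k).
Proof.
move=> fgM projM; have [k [g [f fE]]] := dual_basis fgM projM.
have fB j : {morph (f j : M -> A) : x y / x - y} by move=> x y;
  apply: (linearB (f j)).
exists k; split; apply: (@RightBasis B A M k g (fun j => mkadd (fB j))).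
- move=> j m a; exact: (linearZZ (f j) (a : A^c) (m : right_mod M)).
- by move=> m; apply: fE.
Qed.

Lemma left_basis_exists (B A : pzRingType) (M : bimodType B A) :
  @finitely_generated B M -> @projective B M ->
    exists k, inhabited (left_basis M k).
Proof.
move=> fgM projM; have [k [g [f fE]]] := dual_basis fgM projM.
have fB j : {morph (f j : M -> B) : x y / x - y} by move=> x y;
  apply: (linearB (f j)).
exists k; split; apply: (@LeftBasis B A M k g (fun j => mkadd (fB j))).
- move=> j b m; exact: (linearZZ (f j) b m).
- by move=> m; apply: fE.
Qed.

Section Corner.
Variables (A B : pzRingType) (M : bimodType B A) (N : bimodType A B)
  (L : pzRingType).
Variable C : morita_coords M N L.

Let cE := (ca_mk, cn_mk, cm_mk, cb_mk).
Let coords_mul := (ca_mul, cn_mul, cm_mul, cb_mul).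
Let c0E := (scaler0, scale0r, rscale0l, rscale0r, mulr0, mul0r, addr0, add0r).

Lemma coords_ext x y : ca C x = ca C y -> cn C x = cn C y -> cm C x = cm C y ->
  cb C x = cb C y -> x = y.
Proof. exact: coords_inj. Qed.

Definition jA a := mk C a 0 0 0.
Definition jN n := mk C 0 n 0 0.
Definition jM m := mk C 0 0 m 0.
Definition jB b := mk C 0 0 0 b.

Lemma cn1 : cn C 1 = 0.
Proof.
have := cn_mul C 1 1; rewrite mulr1 ca1 cb1 scale1r rscale1 => e.
by apply: (@addrI _ (cn C 1)); rewrite -e addr0.
Qed.

Lemma cm1 : cm C 1 = 0.
Proof.
have := cm_mul C 1 1; rewrite mulr1 ca1 cb1 scale1r rscale1 => e.
by apply: (@addrI _ (cm C 1)); rewrite -e addr0.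
Qed.

Lemma jA_zmod : {morph jA : a b / a - b}.
Proof. by move=> a b; apply: coords_ext; rewrite raddfB /jA !cE ?subrr. Qed.
Lemma jN_zmod : {morph jN : a b / a - b}.
Proof. by move=> a b; apply: coords_ext; rewrite raddfB /jN !cE ?subrr. Qed.
Lemma jM_zmod : {morph jM : a b / a - b}.
Proof. by move=> a b; apply: coords_ext; rewrite raddfB /jM !cE ?subrr. Qed.
Lemma jB_zmod : {morph jB : a b / a - b}.
Proof. by move=> a b; apply: coords_ext; rewrite raddfB /jB !cE ?subrr. Qed.

HB.instance Definition _ := GRing.isZmodMorphism.Build A L jA jA_zmod.
HB.instance Definition _ := GRing.isZmodMorphism.Build N L jN jN_zmod.
HB.instance Definition _ := GRing.isZmodMorphism.Build M L jM jM_zmod.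
HB.instance Definition _ := GRing.isZmodMorphism.Build B L jB jB_zmod.

Lemma jAM a a' : jA (a * a') = jA a * jA a'.
Proof. by apply: coords_ext; rewrite !coords_mul /jA /jN !cE ?c0E. Qed.

Lemma jAB1 : 1 = jA 1 + jB 1.
Proof. by apply: coords_ext;
  rewrite raddfD ?(ca1, cb1, cn1, cm1) /jA /jB !cE ?c0E. Qed.

Lemma jN_mul n x : jN n * x = jN (n *> cb C x).
Proof. by apply: coords_ext; rewrite !coords_mul /jA /jN !cE ?c0E. Qed.

Lemma jA_mul a x : jA a * x = mk C (a * ca C x) (a *: cn C x) 0 0.
Proof. by apply: coords_ext; rewrite !coords_mul /jA !cE ?c0E. Qed.

Lemma jB_mul b x : jB b * x = mk C 0 0 (b *: cm C x) (b * cb C x).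
Proof. by apply: coords_ext; rewrite !coords_mul /jB !cE ?c0E. Qed.

Lemma mul_jA x a : x * jA a = mk C (ca C x * a) 0 (cm C x *> a) 0.
Proof. by apply: coords_ext; rewrite !coords_mul /jA !cE ?c0E. Qed.

Lemma mul_jM x m : x * jM m = jM (cb C x *: m).
Proof. by apply: coords_ext; rewrite !coords_mul /jM !cE ?c0E. Qed.

Lemma mul_jB x b : x * jB b = mk C 0 (cn C x *> b) 0 (cb C x * b).
Proof. by apply: coords_ext; rewrite !coords_mul /jB !cE ?c0E. Qed.

Lemma jM_mul m x : jM m * x = jM (m *> ca C x).
Proof. by apply: coords_ext; rewrite !coords_mul /jM !cE ?c0E. Qed.
End Corner.

(** * Base change from the Morita ring to a corner *)

Section Descent.
Variables (A B : pzRingType) (M : bimodType B A) (N : bimodType A B)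
  (L : pzRingType).
Variable C : morita_coords M N L.
Variables (k l : nat) (rN : right_basis N k) (lM : left_basis M l).
Hypothesis traceM : forall j n (m : M), rf rN j n *: m = 0.
Hypothesis traceN : forall j m (n : N), n *> lf lM j m = 0.

Local Notation jA := (jA C).
Local Notation jB := (jB C).
Local Notation jM := (jM C).
Local Notation jN := (jN C).

Lemma jN_basis n : jN n = \sum_j jN (rb rN j) * jB (rf rN j n).
Proof.
rewrite {1}(rbE rN n) raddf_sum; apply: eq_bigr => j _.
by rewrite jN_mul cb_mk.
Qed.

(* [Ker (ca C)] acting on [Z]: as a right ideal it is generated by [jB 1] and
   the [jN (rb rN j)]. *)
Definition ideal_act (Z : lmodType L) (z : Z) : Prop :=
  exists w (s : 'I_k -> Z), z = jB 1 *: w + \sum_j jN (rb rN j) *: s j.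

Lemma ideal_act_mul (Z : lmodType L) x (z : Z) : ca C x = 0 ->
  ideal_act (x *: z).
Proof.
move=> x0; exists (x *: z), (fun j => jB (rf rN j (cn C x)) *: z).
rewrite -{1}[x]mul1r [X in X * _](jAB1 C) mulrDl scalerDl addrC scalerA;
  congr (_ + _).
rewrite jA_mul x0 mulr0 scale1r -/(jN _) jN_basis scaler_suml.
by apply: eq_bigr => j _; rewrite scalerA.
Qed.

Lemma ideal_act_submodule (Z : lmodType L) : submodule (@ideal_act Z).
Proof.
have iD (u v : Z) : ideal_act u -> ideal_act v -> ideal_act (u + v).
  move=> [w [s ->]] [w' [s' ->]]; exists (w + w'), (fun j => s j + s' j).
  by rewrite scalerDr addrACA -big_split; congr (_ + _); apply: eq_bigr => j _;
    rewrite scalerDr.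
have i0 : ideal_act (0 : Z).
  by rewrite -[0](scale0r (0 : Z)); apply: ideal_act_mul; apply: raddf0.
split=> // a _ [w [s ->]].
rewrite scalerDr scaler_sumr; apply: (iD).
  by rewrite scalerA; apply: ideal_act_mul; rewrite ca_mul ca_mk mulr0.
apply: (big_ind (@ideal_act Z) i0 iD) => j _.
by rewrite scalerA; apply: ideal_act_mul; rewrite ca_mul ca_mk mulr0.
Qed.

(* [q] exhibits [W] as [A \otimes_L Z], for the projection [L -> A]. *)
Definition base_change (Z : lmodType L) (W : lmodType A)
    (q : {additive Z -> W}) : Prop :=
  [/\ surj q, forall x z, q (x *: z) = ca C x *: q z
    & forall z, q z = 0 <-> ideal_act z].

(** [A] acts on the quotient through the non-unital map [jA]; [jA 1] acts as the identity because
    the complementary idempotent [jB 1] is killed. *)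
Lemma base_change_exists (Z : lmodType L) :
  exists (W : lmodType A) (q : {additive Z -> W}), base_change q.
Proof.
have [V [p [ps pE]]] := quo_exists (ideal_act_submodule Z).
have jA1 (v : V) : jA 1 *: v = v.
  have [z <-] := ps v; rewrite -[RHS]scale1r (jAB1 C) scalerDl -!linearZZ.
  have -> : p (jB 1 *: z) = 0 by apply/pE; apply: ideal_act_mul; rewrite ca_mk.
  by rewrite addr0.
have pB :
    {morph (p : Z -> pullback (jAM C) jA1) : x y / x - y} by exact: linearB.
exists (pullback (jAM C) jA1), (mkadd pB); split=> // x z.
rewrite -[X in mkadd pB X](subrK (jA (ca C x) *: z)) -scalerBl raddfD.
rewrite [X in X + _](_ : _ = 0) ?add0r; first exact: (linearZZ p).
by apply/pE; apply: ideal_act_mul; rewrite raddfB ca_mk subrr.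
Qed.

Lemma base_change_factor (Z : lmodType L) (W U : lmodType A)
    (q : {additive Z -> W}) (f : {additive Z -> U}) :
  base_change q -> (forall x z, f (x *: z) = ca C x *: f z) ->
  exists g : {linear W -> U}, forall z, g (q z) = f z.
Proof.
move=> [/choice[s sE] qZ qE] fZ.
have fs u v : q u = q v -> f u = f v.
  move=> /eqP; rewrite -subr_eq0 -raddfB => /eqP/qE[w [t wE]].
  apply/eqP; rewrite -subr_eq0 -raddfB wE raddfD fZ ca_mk scale0r add0r
    raddf_sum.
  by rewrite big1 // => j _; rewrite fZ ca_mk scale0r.
have lg : linear (fun w => f (s w)).
  move=> a u v; rewrite -{2}(ca_mk C a 0 0 0) -fZ -raddfD; apply: fs.
  by rewrite raddfD qZ !sE ca_mk.
by exists (mklin lg) => z; apply: fs; rewrite sE.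
Qed.

Lemma base_change_fg (Z : lmodType L) (W : lmodType A) (q : {additive Z -> W}) :
  base_change q -> finitely_generated Z -> finitely_generated W.
Proof.
move=> [qs qZ _] /fg_surj[r [p ps]]; apply/fg_surj.
have [f fE] := row_lin_exists (fun j => q (p (delta_mx 0 j))).
exists r, f => w; have [z <-] := qs w; have [v <-] := ps z.
exists (\row_j ca C (v 0 j)); rewrite fE (lin_row p) raddf_sum.
by apply: eq_bigr => j _; rewrite mxE qZ.
Qed.

Hypothesis noethL : noetherian_ring L.

(* [0 -> D -> L (jA 1) -> A -> 0] is exact, where [D], the set of the [jM m],
   is a direct summand of a free module; so the obstruction to lifting
   vanishes. *)
Lemma base_change_lift (Z : lmodType L) (phi : {additive Z -> A}) :
  finitely_generated Z -> semi_gorenstein_projective Z ->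
  (forall x z, phi (x *: z) = ca C x * phi z) ->
  exists h : {linear Z -> L^o}, forall z, ca C (h z) = phi z.
Proof.
move=> fgZ sgZ phiZ.
have [K [fgK sgK [r [i [p [[ii ps ip] exti]]]]]] :=
  semi_gp_syzygy noethL fgZ sgZ.
(* [f] lifts [phi \o p] to the column [L (jA 1)]. On [K] its values lie in [D]; their coordinates in
   [lM] are linear by [traceN], so they extend to the free module. *)
have [f fE] := row_lin_exists (fun j => jA (phi (p (delta_mx 0 j))) : L^o).
have caf v : ca C (f v) = phi (p v).
  rewrite fE (lin_row p) !raddf_sum; apply: eq_bigr => j _.
  by rewrite phiZ scale_regE ca_mul ca_mk.
have cbf v : cb C (f v) = 0.
  by rewrite fE raddf_sum big1 // => j _; rewrite cb_mul cb_mk mulr0.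
have cnf v : cn C (f v) = 0.
  by rewrite fE raddf_sum big1 // => j _;
    rewrite cn_mul cn_mk cb_mk scaler0 rscale0r addr0.
have cafi u : ca C (f (i u)) = 0.
  by rewrite caf (_ : p (i u) = 0) ?raddf0 //; apply/ip; exists u.
have lg t : linear (fun u => jB (lf lM t (cm C (f (i u)))) : L^o).
  move=> a u v; rewrite !linearP raddfD scale_regE cm_mul cafi rscale0r add0r.
  rewrite raddfD lfZ raddfD; congr (_ + _).
  by rewrite mul_jB traceN.
have [h hE] := choice (fun t => exti (mklin (lg t))).
have [psi psiE] := lin_comb_exists h (fun t => jM (lb lM t) : L^o).
have {}psiE v : psi v = \sum_t jM (cb C (h t v) *: lb lM t).
  by rewrite psiE; apply: eq_bigr => t _; rewrite scale_regE mul_jM.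
have psii u : psi (i u) = f (i u).
  rewrite psiE; apply: (coords_ext (C := C)); rewrite ?cafi ?cbf ?cnf raddf_sum.
  - by rewrite big1 // => t _; rewrite ca_mk.
  - by rewrite big1 // => t _; rewrite cn_mk.
  - rewrite [RHS](lbE lM); apply: eq_bigr => t _.
    by rewrite hE mklinE cm_mk cb_mk.
  by rewrite big1 // => t _; rewrite cb_mk.
(* [psi] agrees with [f] on [K] and has values in [D], so [f \- psi] descends to [Z] and still lifts
   [phi]. *)
have [|g gE] := factor_surj (q := p) (f := f \- psi) ps.
  by move=> v /ip[u <-]; rewrite /= psii subrr.
exists g => z; have [v <-] := ps z;
  rewrite gE /= raddfB caf psiE raddf_sum big1 ?subr0 //.
by move=> t _; rewrite ca_mk.
Qed.

Definition map_ca r (v : 'rV[L]_r) : 'rV[A]_r := \row_j ca C (v 0 j).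

Lemma map_ca_zmod r : {morph @map_ca r : u v / u - v}.
Proof. by move=> u v; apply/rowP => j; rewrite !mxE raddfB. Qed.
HB.instance Definition _ r :=
  GRing.isZmodMorphism.Build _ _ (@map_ca r) (@map_ca_zmod r).

Lemma map_caZ r x (v : 'rV[L]_r) : map_ca (x *: v) = ca C x *: map_ca v.
Proof. by apply/rowP => j; rewrite !mxE ca_mul. Qed.

(** Base change is right exact. A functional on [W'] lifts to a map from [K] to [L], which extends
    along [i] and is then reduced by [ca C]. Injectivity of [i'] is left open: it is obtained later
    in two different ways. *)
Lemma base_change_ses (Z : lmodType L) (W : lmodType A)
    (q : {additive Z -> W}) :
  finitely_generated Z -> semi_gorenstein_projective Z -> base_change q ->
  exists (K : lmodType L) r
    (i : {linear K -> 'rV[L]_r}) (p : {linear 'rV[L]_r -> Z})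
    (W' : lmodType A) (q' : {additive K -> W'})
    (i' : {linear W' -> 'rV[A]_r}) (p' : {linear 'rV[A]_r -> W}),
    [/\ finitely_generated K /\ semi_gorenstein_projective K, ses i p,
      base_change q',
      forall x, i' (q' x) = map_ca (i x)
      & [/\ surj p', exact_at i' p' & hom_extends i']].
Proof.
move=> fgZ sgZ [qs qZ qE].
have [K [fgK sgK [r [i [p [ses_ip exti]]]]]] := semi_gp_syzygy noethL fgZ sgZ.
have [ii ps ip] := ses_ip.
have [W' [q' bcq']] := base_change_exists K; have [q's q'Z q'E] := bcq'.
have [|i' i'E] := base_change_factor (f := @map_ca r \o i) bcq'.
  by move=> x z; rewrite /= linearZ map_caZ.
have [p' p'E] := row_lin_exists (fun j => q (p (delta_mx 0 j))).
have p'q v : p' (map_ca v) = q (p v).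
  by rewrite p'E (lin_row p) raddf_sum; apply: eq_bigr => j _; rewrite mxE qZ.
exists K, r, i, p, W', q', i', p'; split=> //; split.
- by move=> w; have [z <-] := qs w; have [v <-] := ps z; exists (map_ca v).
- move=> u; split=> [p'u|[w <-]]; last first.
    have [x <-] := q's w; rewrite i'E p'q (_ : p (i x) = 0) ?raddf0 //.
    by apply/ip; exists x.
  (* [p v] is killed by [q], so it has the shape of [ideal_act]. Subtracting from [v] a preimage of
     the same shape, which [map_ca] kills, brings it into the kernel of [p]. *)
  pose v := \row_j jA (u 0 j).
  have uE : u = map_ca v by apply/rowP => j; rewrite !mxE ca_mk.
  have /qE[w [s psE]] : q (p v) = 0 by rewrite -p'q -uE.
  have [w' w'E] := ps w; have [s' s'E] := choice (fun j => ps (s j)).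
  have /ip[x xE] : p (v - (jB 1 *: w' + \sum_j jN (rb rN j) *: s' j)) = 0.
    rewrite linearB linearD linear_sum linearZ /= w'E psE.
    under [X in _ - (_ + X)]eq_bigr => j _ do rewrite linearZ /= s'E.
    by rewrite subrr.
  exists (q' x); rewrite i'E /= xE uE raddfB raddfD raddf_sum /= map_caZ ca_mk
    scale0r add0r.
  by rewrite big1 ?subr0 // => j _; rewrite map_caZ ca_mk scale0r.
move=> phi.
have [|h hE] := base_change_lift (phi := phi \o q') fgK sgK.
  by move=> x z; rewrite /= q'Z linearZ.
have [H HE] := exti h.
have [Phi PhiE] := row_lin_exists (fun j => ca C (H (delta_mx 0 j)) : A^o).
exists Phi => w; have [x <-] := q's w;
  rewrite i'E PhiE -[RHS]hE -HE (lin_row H) raddf_sum.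
by apply: eq_bigr => j _; rewrite mxE scale_regE ca_mul.
Qed.

(* [Tor_1(A, Z) = 0] for the right [L]-module [A], as [Z] lies in a free module:
   a relation [\sum_j n_j z_j = 0] with [n_j] in [N] is then a consequence of
   the relations [\sum_j nu(n_j) z_j = 0], [nu] ranging over [Hom(N, B)]. *)
Lemma base_change_inj (Z K : lmodType L) r s (i : {linear K -> 'rV[L]_r})
    (p : {linear 'rV[L]_r -> Z}) (e : {linear Z -> 'rV[L]_s}) x :
  injective e -> ses i p -> map_ca (i x) = 0 -> ideal_act x.
Proof.
move=> ei [ii ps ip] ix0.
have ca0 j : ca C (i x 0 j) = 0.
  by have := congr1 (fun u : 'rV_r => u 0 j) ix0; rewrite !mxE.
pose n j := cn C (i x 0 j).
have e1 : jA 1 *: i x = \row_j jN (n j).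
  by apply/rowP => j; rewrite !mxE jA_mul ca0 mulr0 scale1r.
have sum0 c : \sum_j n j *> cb C (e (p (delta_mx 0 j)) 0 c) = 0.
  have : e (p (jA 1 *: i x)) 0 c = 0.
    by rewrite linearZ /= (_ : p (i x) = 0) ?scaler0 ?linear0 ?mxE //; apply/ip;
      exists x.
  rewrite e1 (lin_row p) linear_sum summxE => /(congr1 (cn C));
    rewrite raddf_sum raddf0 => H; rewrite -[RHS]H.
  by apply: eq_bigr => j _; rewrite linearZ /= !mxE jN_mul cn_mk.
(* A functional of [N] applied to the coefficients [n j]. The resulting relation holds in [Z]
   because in the free module [sum0] settles the [B]-coordinate and [traceM] the [M]-coordinate. *)
pose u t := \row_j jB (rf rN t (n j)).
have pu t : p (u t) = 0.
  apply: ei; rewrite linear0; apply/rowP => c; rewrite [RHS]mxE.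
  rewrite (lin_row p) linear_sum summxE.
  under eq_bigr => j _ do rewrite linearZ /= !mxE jB_mul traceM.
  apply: (coords_ext (C := C)); rewrite raddf_sum raddf0.
  - by rewrite big1 // => j _; rewrite ca_mk.
  - by rewrite big1 // => j _; rewrite cn_mk.
  - by rewrite big1 // => j _; rewrite cm_mk.
  under eq_bigr => j _ do rewrite cb_mk -rfZ.
  by rewrite -raddf_sum sum0 raddf0.
have [y yE] := choice (fun t => (ip (u t)).1 (pu t)).
exists x, y.
apply: ii; rewrite linearD linearZ linear_sum /= -{1}[i x]scale1r
  [X in X *: _](jAB1 C).
rewrite scalerDl addrC e1; congr (_ + _).
under eq_bigr => t _ do rewrite linearZ /= yE.
apply/rowP => j; rewrite summxE mxE jN_basis.
by apply: eq_bigr => t _; rewrite !mxE.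
Qed.

Hypothesis noethA : noetherian_ring A.
Hypothesis torsA : forall Z : lmodType A,
  finitely_generated Z -> semi_gorenstein_projective Z -> torsionless Z.

(** The coinductive class consists of base changes of semi-Gorenstein-projective submodules of free
    modules. The syzygy [K] is again one, and [base_change_inj] makes [i'] injective. *)
Lemma base_change_semi_gp_sub (Z : lmodType L) (W : lmodType A)
    (q : {additive Z -> W}) s (e : {linear Z -> 'rV[L]_s}) :
  finitely_generated Z -> semi_gorenstein_projective Z -> injective e ->
  base_change q -> semi_gorenstein_projective W.
Proof.
move=> fgZ sgZ ei bcq.
pose D (W : lmodType A) := exists (Z : lmodType L) (q : {additive Z -> W})
    s (e : {linear Z -> 'rV[L]_s}),
  [/\ finitely_generated Z, semi_gorenstein_projective Z, injective e
    & base_change q].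
apply: (@semi_gp_coind A D); last by exists Z, q, s, e.
move=> {fgZ sgZ ei bcq} W1 [Z1 [q1 [s1 [e1 [fgZ1 sgZ1 ei1 bcq1]]]]].
have [K [r [i [p [W' [q' [i' [p' [[fgK sgK] ses_ip bcq' i'E [p's i'p'
  ext']]]]]]]]]] :=
  base_change_ses fgZ1 sgZ1 bcq1.
have [ii _ _] := ses_ip; have [q's _ q'E] := bcq'.
exists W', 'rV[A]_r, i', p'; split=> //; first by exists K, q', r, i.
  exact: row_projective.
split=> //; apply: ker_inj => w; have [x <-] := q's w; rewrite i'E => ix0.
by apply/q'E; apply: base_change_inj ei1 ses_ip ix0.
Qed.

(** The syzygy [K] lies in a free module, so [W'] is semi-Gorenstein-projective and, by [torsA],
    torsionless. As functionals on [W'] extend along [i'], this forces [i'] to be injective. *)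
Lemma base_change_semi_gp (Z : lmodType L) (W : lmodType A)
    (q : {additive Z -> W}) :
  finitely_generated Z -> semi_gorenstein_projective Z -> base_change q ->
  semi_gorenstein_projective W.
Proof.
move=> fgZ sgZ bcq.
have [K [r [i [p [W' [q' [i' [p' [[fgK sgK] ses_ip bcq' i'E [p's i'p'
  ext']]]]]]]]]] :=
  base_change_ses fgZ sgZ bcq.
have [ii _ _] := ses_ip.
have sgW' := base_change_semi_gp_sub fgK sgK ii bcq'.
have fgW' := base_change_fg bcq' fgK.
have i'i := hom_extends_torsionless ext' (torsA fgW' sgW').
apply: (semi_gp_extension (semi_gp_syzygy noethA) fgW' sgW' (@row_projective A
  r)) ext'.
by split.
Qed.

Lemma detect_corner (Z : lmodType L) (z : Z) :
  finitely_generated Z -> semi_gorenstein_projective Z -> ~ ideal_act z ->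
  exists h : {linear Z -> L^o}, ca C (h z) <> 0.
Proof.
move=> fgZ sgZ nz; have [W [q bcq]] := base_change_exists Z.
have [_ qZ qE] := bcq.
have [|f fz] := torsA (base_change_fg bcq fgZ) (base_change_semi_gp fgZ sgZ bcq)
  (z := q z).
  by move/qE.
have [|h hE] := base_change_lift (phi := f \o q) fgZ sgZ.
  by move=> x y; rewrite /= qZ linearZ.
by exists h; rewrite hE.
Qed.
End Descent.

(** * Induction from a corner to the Morita ring *)

Section Induction.
Variables (A B : pzRingType) (M : bimodType B A) (N : bimodType A B)
  (L : pzRingType).
Variable C : morita_coords M N L.
Variables (k : nat) (rM : right_basis M k).

Local Notation jA := (jA C).
Local Notation jB := (jB C).
Local Notation jM := (jM C).
Local Notation jN := (jN C).
Local Notation mu := (rf rM).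
Local Notation m_ := (rb rM).

(** [b] acts on coordinates by the matrix [mu i (b *: m_ j)]; these matrices multiply like elements
    of [B], but the unit gives only an idempotent. *)
Lemma rf_expand i b m : mu i (b *: m) = \sum_j mu i (b *: m_ j) * mu j m.
Proof.
rewrite {1}(rbE rM m) scaler_sumr raddf_sum; apply: eq_bigr => j _.
by rewrite -rscaleAl rfZ.
Qed.

Section InducedModule.
Variable X : lmodType A.

(* [M \otimes_A X] is the image in [X ^ k] of the idempotent matrix
   [mu i (m_ j)], where [m \otimes x] corresponds to [(mu i m *: x)_i]. *)
Definition induced_proj (b : B) (w : {ffun 'I_k -> X}) : {ffun 'I_k -> X} :=
  [ffun i => \sum_j mu i (b *: m_ j) *: w j].

Definition induced_pred : pred (X * {ffun 'I_k -> X}) :=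
  fun t => t.2 == induced_proj 1 t.2.

Lemma induced_projB b : {morph induced_proj b : v w / v - w}.
Proof.
move=> v w; apply/ffunP => i; rewrite !ffunE -sumrB; apply: eq_bigr => j _.
by rewrite !ffunE scalerBr.
Qed.

Lemma induced_proj0 b : induced_proj b 0 = 0.
Proof. by have := induced_projB b 0 0; rewrite !subrr. Qed.

Lemma induced_pred_closed : zmod_closed induced_pred.
Proof.
split=> [|[x v] [y w]]; rewrite !unfold_in /induced_pred /=.
  by rewrite induced_proj0.
by move=> /eqP ev /eqP ew; rewrite induced_projB -ev -ew.
Qed.

Record induced := Induced { ind_val : X * {ffun 'I_k -> X};
  ind_valP : ind_val \in induced_pred }.
HB.instance Definition _ := [isSub of induced for ind_val].
HB.instance Definition _ := [Choice of induced by <:].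
HB.instance Definition _ :=
  GRing.SubChoice_isSubZmodule.Build _ induced_pred induced induced_pred_closed.

(** The entry of [x] in [N] sends [M \otimes_A X] to zero, as products of [N] and [M] vanish in
    [L]. *)
Definition induced_act (x : L) (t : X * {ffun 'I_k -> X}) :
    X * {ffun 'I_k -> X} :=
  (ca C x *: t.1, [ffun i => mu i (cm C x) *: t.1] + induced_proj (cb C x) t.2).

Lemma induced_proj_mul b b' w : induced_proj b (induced_proj b' w) =
  induced_proj (b * b') w.
Proof.
apply/ffunP => i; rewrite !ffunE.
under eq_bigr => j _ do rewrite ffunE scaler_sumr.
rewrite exchange_big; apply: eq_bigr => j _ /=.
rewrite -scalerA rf_expand scaler_suml; apply: eq_bigr => h _.
by rewrite scalerA.
Qed.

Lemma induced_proj_tensor b m x :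
  induced_proj b [ffun i => mu i m *: x] = [ffun i => mu i (b *: m) *: x].
Proof.
apply/ffunP => i; rewrite !ffunE rf_expand scaler_suml; apply: eq_bigr => j _.
by rewrite ffunE scalerA.
Qed.

Lemma induced_projD b v w : induced_proj b (v + w) =
  induced_proj b v + induced_proj b w.
Proof.
apply/ffunP => i; rewrite !ffunE -big_split; apply: eq_bigr => j _.
by rewrite !ffunE scalerDr.
Qed.

Lemma induced_act_closed x t : induced_act x t \in induced_pred.
Proof.
rewrite unfold_in /induced_pred /=.
by rewrite induced_projD induced_proj_tensor induced_proj_mul mul1r scale1r.
Qed.

Definition induced_scale (x : L) (t : induced) : induced :=
  Induced (induced_act_closed x (ind_val t)).

Lemma induced_scaleA x y t : induced_scale x (induced_scale y t) =
  induced_scale (x * y) t.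
Proof.
apply: val_inj; rewrite /= /induced_act /= ca_mul scalerA; congr pair.
rewrite cb_mul -induced_proj_mul induced_projD addrA; congr (_ + _).
rewrite induced_proj_tensor cm_mul; apply/ffunP => i.
by rewrite !ffunE raddfD rfZ scalerDl scalerA.
Qed.

Lemma induced_scale1 : left_id 1 induced_scale.
Proof.
move=> t; apply: val_inj; case: t => -[x w] wP;
  rewrite /= /induced_act /= ca1 scale1r cm1 cb1.
move: wP; rewrite unfold_in /induced_pred /= => /eqP <-; congr pair.
by apply/ffunP => i; rewrite !ffunE raddf0 scale0r add0r.
Qed.

Lemma induced_scaleDr : right_distributive induced_scale +%R.
Proof.
move=> x t t'; apply: val_inj; rewrite /= /induced_act /= scalerDr; congr pair.
rewrite induced_projD [RHS]addrACA; congr (_ + _).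
by apply/ffunP => i; rewrite !ffunE scalerDr.
Qed.

Lemma induced_scaleDl t : {morph induced_scale^~ t : x y / x + y}.
Proof.
move=> x y; apply: val_inj; rewrite /= /induced_act /= raddfD scalerDl;
  congr pair.
rewrite [RHS]addrACA; congr (_ + _); apply/ffunP => i.
  by rewrite !ffunE !raddfD scalerDl.
rewrite !ffunE -big_split; apply: eq_bigr => j _.
by rewrite raddfD scalerDl raddfD scalerDl.
Qed.

HB.instance Definition _ := GRing.Zmodule_isLmodule.Build L induced
  induced_scaleA induced_scale1 induced_scaleDr induced_scaleDl.
End InducedModule.

Definition corner_linear (X : lmodType A) (W : lmodType L) (f : X ->
  W) : Prop :=
  forall a x, f (a *: x) = jA a *: f x.

Definition spread (X : lmodType A) (W : lmodType L) (f : X -> W) x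
    (w : 'I_k -> X) : W :=
  f x + \sum_j jM (m_ j) *: f (w j).

(* [T] is [L (jA 1) \otimes_A X], and [spread iota x w] is
   [x + \sum_j m_j \otimes w_j]. *)
Definition is_induced (X : lmodType A) (T : lmodType L)
    (iota : {additive X -> T}) : Prop :=
  [/\ corner_linear iota, forall t, exists x w, t = spread iota x w
    & forall x w, spread iota x w = 0 ->
      x = 0 /\ forall i, \sum_j mu i (m_ j) *: w j = 0].

Lemma induced_exists (X : lmodType A) :
  exists (T : lmodType L) (iota : {additive X -> T}), is_induced iota.
Proof.
have iP x : (x, 0) \in @induced_pred X by rewrite unfold_in /induced_pred /=
  induced_proj0.
pose iota x : induced X := Induced (iP x).
have iB : {morph iota : x y / x - y}.
  by move=> x y; apply: val_inj; congr pair; rewrite /= subrr.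
have spreadE x w : val (spread (mkadd iB) x w) =
    (x, [ffun i => \sum_j mu i (m_ j) *: w j]).
  have jME m y : val (jM m *: mkadd iB y) = (0, [ffun i => mu i m *: y]).
    by rewrite /= /induced_act /= ca_mk cm_mk scale0r induced_proj0 addr0.
  rewrite /spread raddfD raddf_sum.
  rewrite (_ : \sum_j _ = (0, \sum_j [ffun i => mu i (m_ j) *: w j])).
    congr pair; rewrite ?addr0 // add0r; apply/ffunP => i.
    by rewrite sum_ffunE !ffunE; apply: eq_bigr => j _; rewrite ffunE.
  apply: (big_ind2 (fun u v => u = (0, v))) => // [u v u' v' -> ->|j _];
    last exact: jME.
  by congr pair; rewrite addr0.
exists (induced X), (mkadd iB); split.
- move=> a x; apply: val_inj;
  rewrite /= /induced_act /= ca_mk cm_mk induced_proj0 addr0.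
  by congr pair; apply/ffunP => i; rewrite !ffunE raddf0 scale0r.
- move=> t; exists (val t).1, (val t).2; apply: val_inj; rewrite spreadE.
  case: t => -[x w] /=; rewrite unfold_in /induced_pred /= => /eqP wE;
    rewrite {1}wE.
  by congr pair; apply/ffunP => i; rewrite !ffunE; apply: eq_bigr => j _;
    rewrite scale1r.
move=> x w /(congr1 val); rewrite spreadE => -[-> w0]; split=> // i.
by have := congr1 (fun f : {ffun 'I_k -> X} => f i) w0; rewrite !ffunE.
Qed.

Lemma jM_expand m : jM m = \sum_j jM (m_ j) * jA (mu j m).
Proof.
rewrite {1}(rbE rM m) raddf_sum; apply: eq_bigr => j _.
by rewrite jM_mul ca_mk.
Qed.

(** Expanding each [m_ h] in the dual basis replaces [w] by its image under the idempotent matrix.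
    This makes maps out of induced modules well defined. *)
Lemma spread0 (X : lmodType A) (W : lmodType L) (f : {additive X -> W}) w :
  corner_linear f -> (forall i, \sum_j mu i (m_ j) *: w j = 0) ->
    spread f 0 w = 0.
Proof.
move=> fZ w0; rewrite /spread raddf0 add0r.
transitivity (\sum_j jM (m_ j) *: f (\sum_h mu j (m_ h) *: w h)); last first.
  by rewrite big1 // => j _; rewrite w0 raddf0 scaler0.
under [RHS]eq_bigr => j _ do rewrite raddf_sum scaler_sumr.
rewrite exchange_big; apply: eq_bigr => h _.
by rewrite {1}jM_expand scaler_suml; apply: eq_bigr => j _; rewrite fZ scalerA.
Qed.

Lemma spreadB (X : lmodType A) (W : lmodType L)
    (f : {additive X -> W}) x y v w :
  spread f x v - spread f y w = spread f (x - y) (fun j => v j - w j).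
Proof.
rewrite /spread raddfB opprD addrACA -sumrB; congr (_ + _);
  apply: eq_bigr => j _.
by rewrite raddfB scalerBr.
Qed.

Lemma spreadD (X : lmodType A) (W : lmodType L)
    (f : {additive X -> W}) x y v w :
  spread f x v + spread f y w = spread f (x + y) (fun j => v j + w j).
Proof.
rewrite /spread raddfD addrACA -big_split; congr (_ + _); apply: eq_bigr => j _.
by rewrite raddfD scalerDr.
Qed.

Lemma spreadZ (X : lmodType A) (W : lmodType L) (f : {additive X -> W}) a x w :
  corner_linear f -> a *: spread f x w = spread f (ca C a *: x)
    (fun i => mu i (cm C a) *: x + \sum_j mu i (cb C a *: m_ j) *: w j).
Proof.
move=> fZ; have fx y : f y = jA 1 *: f y by rewrite -fZ scale1r.
rewrite /spread scalerDr scaler_sumr fZ.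
under [in RHS]eq_bigr => i _ do rewrite raddfD scalerDr raddf_sum scaler_sumr.
rewrite big_split /= addrA; congr (_ + _).
  rewrite {1}fx scalerA mul_jA mulr1 rscale1.
  rewrite (_ : mk C (ca C a) 0 (cm C a) 0 = jA (ca C a) + jM (cm C a));
    last first.
    by apply: (coords_ext (C := C));
      rewrite raddfD ?(ca_mk, cn_mk, cm_mk, cb_mk) ?addr0 ?add0r.
  rewrite scalerDl jM_expand scaler_suml; congr (_ + _).
  by apply: eq_bigr => i _; rewrite fZ scalerA.
rewrite exchange_big; apply: eq_bigr => j _ /=.
rewrite scalerA mul_jM jM_expand scaler_suml; apply: eq_bigr => i _.
by rewrite fZ scalerA.
Qed.

Lemma spread_lin (X : lmodType A) (T W : lmodType L) (f : X ->
  T) (g : {linear T -> W}) x w :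
  g (spread f x w) = spread (fun y => g (f y)) x w.
Proof.
rewrite /spread linearD linear_sum; congr (_ + _); apply: eq_bigr => j _.
by rewrite linearZ.
Qed.

Lemma eq_spread (X : lmodType A) (T : lmodType L) (f g : X -> T) x w :
  f =1 g -> spread f x w = spread g x w.
Proof. by move=> fg; rewrite /spread fg; congr (_ + _); apply: eq_bigr => j _;
  rewrite fg. Qed.

Section Universal.
Variables (X : lmodType A) (T : lmodType L) (iota : {additive X -> T}).
Hypothesis indT : is_induced iota.

Lemma induced_uniq (W : lmodType L) (g h : {linear T -> W}) :
  (forall x, g (iota x) = h (iota x)) -> g =1 h.
Proof.
move=> gh t; have [_ /(_ t)[x [w ->]] _] := indT.
by rewrite !spread_lin; apply: eq_spread.
Qed.

Lemma induced_lift (W : lmodType L) (f : {additive X -> W}) :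
  corner_linear f -> exists g : {linear T -> W}, forall x, g (iota x) = f x.
Proof.
move=> fZ; have [iZ iS i0] := indT.
have [x xE] := choice iS; have [w wE] := choice xE.
have wd y v y' v' : spread iota y v = spread iota y' v' ->
  spread f y v = spread f y' v'.
  move=> /eqP; rewrite -subr_eq0 spreadB => /eqP/i0[yy0 vv0].
  by apply/eqP; rewrite -subr_eq0 spreadB yy0; apply/eqP/spread0.
have lg : linear (fun t => spread f (x t) (w t)).
  move=> a t t'; rewrite spreadZ // spreadD; apply: wd.
  by rewrite -spreadD -spreadZ // -!wE.
exists (mklin lg) => y; rewrite mklinE.
have -> : f y = spread f y (fun=> 0).
  by rewrite /spread big1 ?addr0 // => j _; rewrite raddf0 scaler0.
apply: wd; rewrite -wE /spread big1 ?addr0 // => j _.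
by rewrite raddf0 scaler0.
Qed.

Lemma iota_inj x : iota x = 0 -> x = 0.
Proof.
move=> ix; have [_ _ i0] := indT; have [|//] := i0 x (fun=> 0).
by rewrite /spread ix big1 ?addr0 // => j _; rewrite raddf0 scaler0.
Qed.

Lemma induced_fg : finitely_generated X -> finitely_generated T.
Proof.
move=> /fg_surj[r [p ps]]; apply/fg_surj; have [iZ iS _] := indT.
have [f fE] := row_lin_exists (fun j => iota (p (delta_mx 0 j))).
have fs y : exists v, f v = iota y.
  have [u <-] := ps y; exists (\row_j jA (u 0 j)).
  rewrite fE (lin_row p) raddf_sum; apply: eq_bigr => j _.
  by rewrite mxE iZ.
exists r, f => t; have [x [w ->]] := iS t.
have [u uE] := fs x; have [v vE] := choice (fun j => fs (w j)).
exists (u + \sum_j jM (m_ j) *: v j).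
rewrite linearD linear_sum uE; congr (_ + _); apply: eq_bigr => j _.
by rewrite linearZ /= vE.
Qed.
End Universal.

Lemma induced_projective r (T : lmodType L) (iota : {additive 'rV[A]_r -> T}) :
  is_induced iota -> projective T.
Proof.
move=> indT U V g f gs; have [iZ _ _] := indT.
have [u uE] := choice (fun j : 'I_r => gs (f (iota (delta_mx 0 j)))).
pose phi (v : 'rV[A]_r) := \sum_j jA (v 0 j) *: u j.
have phiB : {morph phi : v w / v - w}.
  move=> v w; rewrite -sumrB; apply: eq_bigr => j _.
  by rewrite !mxE raddfB scalerBl.
have [|h hE] := induced_lift indT (f := mkadd phiB).
  move=> a v; rewrite mkaddE scaler_sumr; apply: eq_bigr => j _.
  by rewrite mxE jAM scalerA.
exists h => t; apply: (induced_uniq indT (g := g \o h) (h := f)) => v /=.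
rewrite hE mkaddE linear_sum [in RHS](row_sum v) !raddf_sum;
  apply: eq_bigr => j _.
by rewrite linearZ /= uE iZ linearZ.
Qed.

Hypothesis fgN : @finitely_generated A N.
Hypothesis projN : @projective A N.

(** [iota x] is fixed by [jA 1], so [h] sends it into the row [jA 1 * L], which is [A \oplus N] as a
    left [A]-module. *)
Lemma induced_coords (X : lmodType A) (T : lmodType L)
    (iota : {additive X -> T}) (h : {linear T -> L^o}) : corner_linear iota ->
  exists (f : {linear X -> A^o}) (g : {linear X -> N}),
    forall x, h (iota x) = mk C (f x) (g x) 0 0.
Proof.
move=> iZ.
have lf : linear (fun x => ca C (h (iota x)) : A^o).
  by move=> a x y; rewrite raddfD iZ linearP raddfD scale_regE ca_mul ca_mk.
have lg : linear (fun x => cn C (h (iota x))).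
  move=> a x y; rewrite raddfD iZ linearP raddfD scale_regE cn_mul ca_mk cn_mk.
  by rewrite rscale0l addr0.
exists (mklin lf), (mklin lg) => x; rewrite !mklinE.
by rewrite -[x]scale1r iZ linearZ /= scale_regE jA_mul !(ca_mk, cn_mk).
Qed.

(** Exactness is checked on the [spread] presentations. A functional on [TK] amounts to a map from
    [K] to [A \oplus N], whose components extend along [i], the second since [N] is finitely
    generated projective. *)
Lemma induced_ses (K P X : lmodType A) (i : {linear K -> P})
    (p : {linear P -> X})
    (TK TP TX : lmodType L) (iK : {additive K -> TK}) (iP : {additive P -> TP})
    (iX : {additive X -> TX}) :
  is_induced iK -> is_induced iP -> is_induced iX -> ses i p -> hom_extends i ->
  exists (Ti : {linear TK -> TP}) (Tp : {linear TP -> TX}),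
    ses Ti Tp /\ hom_extends Ti.
Proof.
move=> indK indP indX [ii ps ip] exti.
have [KZ KS K0] := indK; have [PZ PS P0] := indP; have [XZ XS X0] := indX.
have [|Ti TiE] := induced_lift indK (f := iP \o i).
  by move=> a x; rewrite /= linearZ PZ.
have [|Tp TpE] := induced_lift indP (f := iX \o p).
  by move=> a x; rewrite /= linearZ XZ.
have Tis x w : Ti (spread iK x w) = spread iP (i x) (fun j => i (w j)).
  by rewrite spread_lin (eq_spread _ _ TiE).
have Tps x w : Tp (spread iP x w) = spread iX (p x) (fun j => p (w j)).
  by rewrite spread_lin (eq_spread _ _ TpE).
exists Ti, Tp; split; first split.
- apply: ker_inj => t; have [x [w ->]] := KS t; rewrite Tis => /P0[ix iw].
  have -> : x = 0 by apply: ii; rewrite linear0.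
  apply: spread0 => // j; apply: ii; rewrite linear0 -[RHS](iw j) linear_sum.
  by apply: eq_bigr => h _; rewrite linearZ.
- move=> t; have [x [w ->]] := XS t.
  have [y yE] := ps x; have [v vE] := choice (fun j => ps (w j)).
  exists (spread iP y v); rewrite Tps yE /spread; congr (_ + _).
  by apply: eq_bigr => j _; rewrite vE.
- move=> t; split=> [|[u <-]]; last first.
    rewrite -[LHS]/((Tp \o Ti) u) (induced_uniq indK (g := Tp \o Ti)
      (h := \0)) // => x.
    by rewrite /= TiE TpE /= (_ : p (i x) = 0) ?raddf0 //; apply/ip; exists x.
  have [x [w ->]] := PS t; rewrite Tps => /X0[px pw].
  have /ip[y yE] := px.
  (* Only the image of [w] under the idempotent matrix is known to be killed by [p]. It is lifted
     instead, and by [rf_expand] it represents the same element as [w]. *)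
  have [v vE] : {v & forall j, i (v j) = \sum_h mu j (m_ h) *: w h}.
    apply: (@choice _ _ (fun j u => i u = \sum_h mu j (m_ h) *: w h)) => j;
      apply/ip; rewrite -[RHS](pw j) linear_sum.
    by apply: eq_bigr => h _; rewrite linearZ.
  exists (spread iK y v); rewrite Tis yE; apply/eqP;
    rewrite -subr_eq0 spreadB subrr.
  apply/eqP/spread0 => // j.
  under eq_bigr => h _ do rewrite vE scalerBr scaler_sumr.
  rewrite sumrB exchange_big /= -sumrB big1 // => h _; apply/eqP;
    rewrite subr_eq0; apply/eqP.
  have := rf_expand j 1 (m_ h); rewrite !scale1r => ->.
  by rewrite scaler_suml; apply: eq_bigr => g _; rewrite scalerA scale1r.
move=> h; have [f [g hE]] := induced_coords h KZ.
have [a aE] := exti f.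
have [n nE] := hom_extends_projective exti fgN projN g.
have fB : {morph (fun v => mk C (a v) (n v) 0 0 : L^o) : u v / u - v}.
  move=> u v; apply: (coords_ext (C := C));
    rewrite [RHS]raddfB /= !(ca_mk, cn_mk, cm_mk, cb_mk) ?subrr //.
    exact: linearB.
  exact: linearB.
have [|F FE] := induced_lift indP (f := mkadd fB).
  by move=> c x; rewrite !mkaddE [RHS]scale_regE jA_mul ca_mk cn_mk !linearZ.
exists F; apply: (induced_uniq indK (g := F \o Ti) (h := h)) => x /=.
by rewrite TiE /= FE mkaddE aE nE hE.
Qed.

Hypothesis noethA : noetherian_ring A.

Lemma induced_semi_gp (X : lmodType A) (T : lmodType L)
    (iota : {additive X -> T}) :
  finitely_generated X -> semi_gorenstein_projective X -> is_induced iota ->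
  semi_gorenstein_projective T.
Proof.
move=> fgX sgX indT.
pose D (T : lmodType L) := exists (X : lmodType A) (iota : {additive X -> T}),
  [/\ finitely_generated X, semi_gorenstein_projective X & is_induced iota].
apply: (@semi_gp_coind L D); last by exists X, iota.
move=> {fgX sgX indT} T1 [X1 [iota1 [fgX sgX indT]]].
have [K [fgK sgK [r [i [p [ses_ip exti]]]]]] := semi_gp_syzygy noethA fgX sgX.
have [TK [iK indK]] := induced_exists K.
have [TP [iP indP]] := induced_exists 'rV[A]_r.
have [Ti [Tp [sesT extT]]] := induced_ses indK indP indT ses_ip exti.
exists TK, TP, Ti, Tp; split=> //; first by exists K, iK.
exact: induced_projective indP.
Qed.

(** A functional on the induced module that is nonzero at [iota x] has a nonzero component in [A] or
    in the torsionless module [N]. *)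
Lemma torsionless_corner :
  (forall Z : lmodType L, finitely_generated Z ->
    semi_gorenstein_projective Z -> torsionless Z) ->
  forall X : lmodType A, finitely_generated X -> semi_gorenstein_projective X ->
    torsionless X.
Proof.
move=> torsL X fgX sgX x x0; have [T [iota indT]] := induced_exists X.
have [iZ _ _] := indT.
have [|h hx] := torsL T (induced_fg indT fgX) (induced_semi_gp fgX sgX indT)
  (iota x).
  by move/(iota_inj indT).
have [f [g hE]] := induced_coords h iZ.
have [fx0|fx] := pselect (f x = 0); last by exists f.
have [|e ge] := dual_basis_torsionless fgN projN (z := g x);
  last by exists (e \o g).
by move=> gx0; apply: hx; rewrite hE fx0 gx0; apply: (raddf0 jA).
Qed.
End Induction.

(** * The Morita ring *)

Lemma artin_algebra_lwgP (R : comPzRingType) (S : pzRingType)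
  (i : {rmorphism R -> S}) :
  artin_algebra i ->
  left_weakly_gorenstein S <-> forall Z : lmodType S,
    finitely_generated Z -> semi_gorenstein_projective Z -> torsionless Z.
Proof.
move=> artS; split; first exact: lwg_torsionless.
apply: torsionless_lwg; first exact: artin_algebra_noetherian artS.
exact: artin_algebra_left_approximations artS.
Qed.

Section MoritaTorsionless.
Variables (A B : pzRingType) (M : bimodType B A) (N : bimodType A B)
  (L : pzRingType).
Variables (k k' l l' : nat) (rN : right_basis N k) (lM : left_basis M l).
Variables (rM : right_basis M k') (lN : left_basis N l').
Hypothesis traceM : forall j n (m : M), rf rN j n *: m = 0.
Hypothesis traceN : forall j m (n : N), n *> lf lM j m = 0.
Hypothesis traceN' : forall j m (n : N), rf rM j m *: n = 0.
Hypothesis traceM' : forall j n (m : M), m *> lf lN j n = 0.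
Hypotheses (noethA : noetherian_ring A) (noethB : noetherian_ring B)
  (noethL : noetherian_ring L).
Hypothesis torsA : forall Z : lmodType A,
  finitely_generated Z -> semi_gorenstein_projective Z -> torsionless Z.
Hypothesis torsB : forall Z : lmodType B,
  finitely_generated Z -> semi_gorenstein_projective Z -> torsionless Z.

Lemma morita_detect (C : morita_coords M N L) (Z : lmodType L) (z : Z) :
  finitely_generated Z -> semi_gorenstein_projective Z ->
  jA C 1 *: z <> 0 -> exists h : {linear Z -> L^o}, h z <> 0.
Proof.
move=> fgZ sgZ; set x := jA C 1 *: z => x0.
suff [h hx] : exists h : {linear Z -> L^o}, h x <> 0.
  by exists h => hz; apply: hx; rewrite /x linearZ /= hz scaler0.
have [[w [s xE]]|nx] := pselect (ideal_act C rN x); last first.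
  have [h hx] := detect_corner traceM traceN noethL noethA torsA fgZ sgZ nx.
  by exists h => hx0; apply: hx; rewrite hx0 raddf0.
have {w}xE : x = \sum_j jN C (rb rN j) *: s j.
  have -> : x = jA C 1 *: x by rewrite /x scalerA -jAM mulr1.
  rewrite xE scalerDr scalerA jA_mul ca_mk cn_mk mulr0 scaler0.
  rewrite [mk C _ _ _ _](raddf0 (jA C)) scale0r add0r scaler_sumr.
  by apply: eq_bigr => j _; rewrite scalerA jA_mul ca_mk cn_mk scale1r mulr0.
(* If every [y i] vanishes in the base change to [B], the trace ideal of [N] kills it; then
   [y_i = \sum_t rf_i(n_t) y_t = 0], and [x = \sum_i n_i y_i] is zero. *)
pose y i := \sum_j jB C (rf rN i (rb rN j)) *: s j.
have [yI|] := pselect (forall i, ideal_act (swap_coords C) rM (y i)).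
  have mk0 : mk C 0 0 0 0 = 0 by exact: (raddf0 (jA C)).
  have killI i n (u : Z) : ideal_act (swap_coords C) rM u ->
    jB C (rf rN i n) *: u = 0.
    move=> [w' [s' ->]]; rewrite scalerDr scaler_sumr scalerA jB_mul.
    rewrite [cm C _](cm_mk C 1 0 0 0) [cb C _](cb_mk C 1 0 0 0) scaler0 mulr0
      mk0 scale0r add0r.
    rewrite big1 // => j _; rewrite scalerA jB_mul.
    by rewrite [cm C _](cm_mk C 0 0 _ 0) [cb C _](cb_mk C 0 0 _ 0) traceM mulr0
      mk0 scale0r.
  case: x0; rewrite xE.
  transitivity (\sum_i jN C (rb rN i) *: y i).
    under [RHS]eq_bigr => i _ do rewrite scaler_sumr.
    rewrite exchange_big; apply: eq_bigr => j _ /=.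
    by rewrite {1}(jN_basis C rN) scaler_suml; apply: eq_bigr => i _;
      rewrite scalerA.
  rewrite big1 // => i _; rewrite (_ : y i = 0) ?scaler0 //.
  transitivity (\sum_t jB C (rf rN i (rb rN t)) *: y t);
    last by rewrite big1 // => t _; apply: killI.
  under [RHS]eq_bigr => t _ do rewrite scaler_sumr.
  rewrite exchange_big; apply: eq_bigr => j _ /=.
  rewrite {1}(rbE rN (rb rN j)) !raddf_sum scaler_suml; apply: eq_bigr => t _.
  by rewrite rfZ scalerA jB_mul cm_mk cb_mk scaler0.
move=> /existsNP[i nyi].
have [h hy] := detect_corner (C :=
  swap_coords C) traceN' traceM' noethL noethB torsB fgZ sgZ nyi.
(* If [h x = 0], applying [rf rN i] to its [N]-coordinate shows that the [B]-coordinate of [h (y i)]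
   is zero. *)
exists h => hx; apply: hy.
have hxE : \sum_j rb rN j *> cb C (h (s j)) = 0.
  rewrite -[RHS](raddf0 (cn C)) -hx xE linear_sum raddf_sum;
    apply: eq_bigr => j _.
  by rewrite linearZ /= scale_regE jN_mul cn_mk.
rewrite -[LHS]/(cb C (h (y i))) /y linear_sum raddf_sum -[RHS](raddf0 (rf rN i))
  -hxE raddf_sum.
apply: eq_bigr => j _.
by rewrite linearZ /= scale_regE jB_mul cb_mk rfZ.
Qed.
End MoritaTorsionless.

(** * Trace ideals and vanishing tensor products *)

Lemma tensor_eq0_balanced (S : pzRingType) (U : lmodType S^c) (V : lmodType S)
    (W : zmodType) (f : U -> V -> W) u v :
  tensor_eq0 U V -> balanced f -> f u v = 0.
Proof.
move=> [T [t [[_ univ] T0]]] /univ[h [<- _]].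
by rewrite (T0 (t u v)) raddf0.
Qed.

(** As a function of [n] and [m] the product is balanced over [B], so it factors through the zero
    tensor product. *)
Lemma tensor_eq0_left_trace (A B : pzRingType) (M : bimodType B A)
  (N : bimodType A B)
    k (rN : right_basis N k) j n (m : M) :
  tensor_eq0 (right_mod N) M -> rf rN j n *: m = 0.
Proof.
move=> NM0.
apply: (tensor_eq0_balanced (f :=
  fun (n : right_mod N) (m : M) => rf rN j n *: m) n m NM0).
split=> [u u' v|u v v'|a u v].
- by rewrite (raddfD (rf rN j)) scalerDl.
- exact: scalerDr.
by rewrite [rf rN j _](rfZ rN j u a) scalerA.
Qed.

Lemma tensor_eq0_right_trace (A B : pzRingType) (M : bimodType B A)
  (N : bimodType A B)
    l (lM : left_basis M l) j m (n : N) :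
  tensor_eq0 (right_mod N) M -> n *> lf lM j m = 0.
Proof.
move=> NM0.
apply: (tensor_eq0_balanced (f :=
  fun (n : right_mod N) (m : M) => (n : N) *> lf lM j m) n m NM0).
split=> [u u' v|u v v'|a u v].
- exact: rscaleDl.
- by rewrite raddfD rscaleDr.
by rewrite lfZ -rscaleA.
Qed.

Lemma central_fg_left (R : comPzRingType) (A B : pzRingType)
  (iB : {rmorphism R -> B})
    (iA : {rmorphism R -> A}) (M : bimodType B A) :
  central_fg_bimodule iB iA M -> @finitely_generated B M.
Proof. by move=> [_ [s sM]]; exists s => m; have [c ->] := sM m;
  exists (iB \o c). Qed.

Lemma central_fg_right (R : comPzRingType) (A B : pzRingType)
  (iB : {rmorphism R -> B})
    (iA : {rmorphism R -> A}) (M : bimodType B A) :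
  central_fg_bimodule iB iA M -> finitely_generated (right_mod M).
Proof.
move=> [cM [s sM]]; exists s => m; have [c mE] := sM m;
  exists (fun k => iA (c k) : A^c).
by rewrite [LHS]mE; apply: eq_bigr => k _; apply: cM.
Qed.

Section MoritaRingCoords.
Variables (A B : pzRingType) (M : bimodType B A) (N : bimodType A B).
Local Notation L := (morita M N).

Lemma mor_a_zmod : {morph (fun x : L => mor_a x) : x y / x - y}.
Proof. by []. Qed.

Lemma mor_n_zmod : {morph (fun x : L => mor_n x) : x y / x - y}.
Proof. by []. Qed.

Lemma mor_m_zmod : {morph (fun x : L => mor_m x) : x y / x - y}.
Proof. by []. Qed.

Lemma mor_b_zmod : {morph (fun x : L => mor_b x) : x y / x - y}.
Proof. by []. Qed.


Definition morita_ring_coords : morita_coords M N L.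
Proof.
apply: (@MoritaCoords A B M N L (@Morita A B M N) (mkadd mor_a_zmod)
  (mkadd mor_n_zmod)
  (mkadd mor_m_zmod) (mkadd mor_b_zmod)) => //.
by case=> [a n m b] [a' n' m' b']; rewrite !mkaddE /= => -> -> -> ->.
Defined.
End MoritaRingCoords.

Theorem theorem1p6
  (R : comPzRingType) (A B : pzRingType)
  (iA : {rmorphism R -> A}) (iB : {rmorphism R -> B})
  (M : bimodType B A) (N : bimodType A B)
  (artA : artin_algebra iA) (artB : artin_algebra iB)
  (fgM : central_fg_bimodule iB iA M) (fgN : central_fg_bimodule iA iB N)
  (MN0 : tensor_eq0 (right_mod M) N) (NM0 : tensor_eq0 (right_mod N) M)
  (projBM : @projective B M) (projAN : @projective A N)
  (projMA : projective (right_mod M)) (projNB : projective (right_mod N)) :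
  left_weakly_gorenstein (morita M N) <->
  left_weakly_gorenstein A /\ left_weakly_gorenstein B.
Proof.
have artL := morita_artin_algebra artA artB fgM fgN.
have noethA := artin_algebra_noetherian artA.
have noethB := artin_algebra_noetherian artB.
have noethL := artin_algebra_noetherian artL.
have [kM [rM]] := right_basis_exists (central_fg_right fgM) projMA.
have [kN [rN]] := right_basis_exists (central_fg_right fgN) projNB.
have [lM' [lM]] := left_basis_exists (central_fg_left fgM) projBM.
have [lN' [lN]] := left_basis_exists (central_fg_left fgN) projAN.
pose C := morita_ring_coords M N.
rewrite (artin_algebra_lwgP artA) (artin_algebra_lwgP artB)
  (artin_algebra_lwgP artL).
split=> [torsL|[torsA torsB] Z fgZ sgZ z z0].
  split; first exact: (torsionless_corner C rM (central_fg_left fgN) projAN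
    noethA torsL).
  exact: (torsionless_corner (swap_coords C) rN (central_fg_left fgM) projBM
    noethB torsL).
have tM j n (m : M) := tensor_eq0_left_trace rN j n m NM0.
have tN j m (n : N) := tensor_eq0_right_trace lM j m n NM0.
have tN' j m (n : N) := tensor_eq0_left_trace rM j m n MN0.
have tM' j n (m : M) := tensor_eq0_right_trace lN j n m MN0.
(* [z] is the sum of [jA C 1 *: z] and [jB C 1 *: z], so one of them is nonzero; the second case is
   the first with the corners exchanged. *)
have [xA|xA] := pselect (jA C 1 *: z = 0); last first.
  exact: (morita_detect tM tN tN' tM' noethA noethB noethL torsA torsB fgZ sgZ
    xA).
apply: (morita_detect (C :=
  swap_coords C) tN' tM' tM tN noethB noethA noethL torsB torsA fgZ sgZ (z :=
    z)).
by move=> xB; apply: z0; rewrite -[z]scale1r (jAB1 C) scalerDl xA [jB C 1 *: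
  z]xB addr0.
Qed.
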